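(* Let $\mathfrak{g}$ be a Lie algebra with a fixed triangular decomposition $\mathfrak{g}=\mathfrak{n}_-\oplus\mathfrak{h}\oplus\mathfrak{n}_+$ and set $\mathfrak{n}=\mathfrak{n}_+$. Let $\mu\in \mathfrak{h}^*$ and $\lambda\in(\mathfrak{n}/[\mathfrak{n},\mathfrak{n}])^*$. Then $L(\lambda,\mu)$ is a simple $\mathfrak{g}$-module and satisfies $\dim W_{\lambda}(L(\lambda,\mu))=1$.
   Context: Everything is over $\mathbb{C}$; $\mathfrak{g}$ may be infinite dimensional, of at most countable dimension. Triangular decomposition (in the sense of Moody–Pianzola): $\mathfrak{g}=\mathfrak{n}_-\oplus\mathfrak{h}\oplus\mathfrak{n}_+$ as vector spaces, where $\mathfrak{h}\ne0$ is an abelian subalgebra, $\mathfrak{n}_\pm$ are nonzero subalgebras stable under $\mathrm{ad}\,\mathfrak{h}$; $\mathfrak{n}_+$ is the direct sum of its $\mathfrak{h}$-weight spaces, which are finite dimensional, with all weights in $Q_+\setminus\{0\}$, where $Q_+\subset\mathfrak{h}^*$ is the additive monoid generated by some linearly independent subset of $\mathfrak{h}^*$; and there is an involutive anti-automorphism $\sigma$ of $\mathfrak{g}$ with $\sigma(\mathfrak{n}_+)=\mathfrak{n}_-$ and $\sigma|_{\mathfrak{h}}=\mathrm{id}$. Elements of $(\mathfrak{n}/[\mathfrak{n},\mathfrak{n}])^*$ are identified with Lie algebra homomorphisms $\mathfrak{n}\to\mathbb{C}$. For a $\mathfrak{g}$-module $M$, $W_\lambda(M)=\{v\in M: xv=\lambda(x)v\text{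 for all }x\in\mathfrak{n}\}$. $L_\lambda=\langle v_\lambda\rangle$ is the one-dimensional $\mathfrak{n}$-module given by $\lambda$, and $M_\lambda=U(\mathfrak{g})\otimes_{U(\mathfrak{n})}L_\lambda$ is the standard Whittaker module. $N(-\mu)=U(\mathfrak{g})\otimes_{U(\mathfrak{h}\oplus\mathfrak{n}_-)}\mathbb{C}_{-\mu}$ is the lowest weight Verma module, where $\mathfrak{n}_-$ acts by $0$ and $h\in\mathfrak{h}$ by $-\mu(h)$ on $\mathbb{C}_{-\mu}$. Its full dual space $N(-\mu)^*$ is a $\mathfrak{g}$-module via $(xf)(v)=f(-xv)$. For all $\lambda,\mu$ the space $W_\lambda(N(-\mu)^* )$ is one-dimensional, so there is a unique (up to scalar) nonzero homomorphism $M_\lambda\to N(-\mu)^*$; it sends $1\otimes v_\lambda$ to a nonzero vector of $W_\lambda(N(-\mu)^* )$. $L(\lambda,\mu)$ denotes the image of this homomorphism. *)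

(* Defs.v *)
From HB Require Import structures.
From mathcomp Require Import all_boot all_order all_algebra.
From mathcomp Require Import finmap.
From mathcomp.multinomials Require Import monalg.
From mathcomp Require Import boolp classical_sets functions reals.
From mathcomp.real_closed Require Import complex.

Set Implicit Arguments.
Unset Strict Implicit.
Unset Printing Implicit Defensive.

Import GRing.Theory.

Local Open Scope quotient_scope.
Local Open Scope classical_set_scope.
Local Open Scope ring_scope.

Record subspace (K : fieldType) (V : lmodType K) := Subspace {
  in_subspace :> V -> Prop;
  subspace0 : in_subspace 0;
  subspaceP : forall (c : K) (u v : V),
    in_subspace u -> in_subspace v -> in_subspace (c *: u + v)
}.

Section SubspaceTheory.
Variables (K : fieldType) (V : lmodType K) (W : subspace V).

Lemma subspaceZ (c : K) (u : V) : W u -> W (c *: u).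
Proof.
by move=> Wu; rewrite -[_ *: _]addr0; apply: subspaceP => //; apply: subspace0.
Qed.

Lemma subspaceD (u v : V) : W u -> W v -> W (u + v).
Proof. by move=> Wu Wv; rewrite -[u]scale1r; apply: subspaceP. Qed.

Lemma subspaceN (u : V) : W u -> W (- u).
Proof. by move=> Wu; rewrite -scaleN1r; apply: subspaceZ. Qed.

Lemma subspaceB (u v : V) : W u -> W v -> W (u - v).
Proof. by move=> Wu Wv; apply: subspaceD => //; apply: subspaceN. Qed.

Definition subspace_pred : {pred V} := fun v => `[< W v >].

Lemma subspace_predP (v : V) : reflect (W v) (v \in subspace_pred).
Proof. exact: asboolP. Qed.

Lemma subspace_pred_closed : submod_closed subspace_pred.
Proof.
split; first exact/subspace_predP/subspace0.
by move=> c u v /subspace_predP Wu /subspace_predP Wv; apply/subspace_predP/subspaceP.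
Qed.

HB.instance Definition _ :=
  GRing.isSubmodClosed.Build K V subspace_pred subspace_pred_closed.

(* The subspace W as a vector space in its own right; [val] is the inclusion. *)
Definition subspace_type : Type := {v : V | v \in subspace_pred}.
HB.instance Definition _ := SubChoice.on subspace_type.
HB.instance Definition _ := [SubChoice_isSubZmodule of subspace_type by <:].
HB.instance Definition _ := [SubZmodule_isSubLmodule of subspace_type by <:].

Lemma subspace_valP (w : subspace_type) : W (val w).
Proof. exact/subspace_predP/(valP w). Qed.

Definition in_sub (v : V) (Wv : W v) : subspace_type :=
  exist _ v (introT (subspace_predP v) Wv).

Definition quotient_space : Type := Quotient.quot subspace_pred.
HB.instance Definition _ := GRing.Zmodule.on quotient_space.

Definition to_quot (v : V) : quotient_space :=
  \pi_(Quotient.quot subspace_pred) v.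

Definition quot_repr (q : quotient_space) : V :=
  repr (q : Quotient.quot subspace_pred).

Lemma quot_reprK (q : quotient_space) : to_quot (quot_repr q) = q.
Proof. exact: reprK. Qed.

Lemma to_quotP (u v : V) : to_quot u = to_quot v <-> W (u - v).
Proof.
split=> [/eqP|Wuv]; rewrite /to_quot.
  by rewrite eqmodE => /subspace_predP.
by apply/eqP; rewrite eqmodE; apply/subspace_predP.
Qed.

Lemma to_quotB : {morph to_quot : u v / u - v}.
Proof. by move=> u v; rewrite /to_quot !piE. Qed.

Lemma to_quotD : {morph to_quot : u v / u + v}.
Proof. by move=> u v; rewrite /to_quot !piE. Qed.

Lemma to_quot0 : to_quot 0 = 0.
Proof. by rewrite /to_quot !piE. Qed.

Lemma quot_ind (P : quotient_space -> Prop) :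
  (forall v, P (to_quot v)) -> forall q, P q.
Proof. by move=> Pv q; rewrite -[q]quot_reprK. Qed.

Lemma quot_repr_to_quot (v : V) : W (quot_repr (to_quot v) - v).
Proof. by apply/to_quotP; rewrite quot_reprK. Qed.

Definition quot_scale (c : K) (q : quotient_space) : quotient_space :=
  to_quot (c *: quot_repr q).

Lemma quot_scale_to_quot (c : K) (v : V) :
  quot_scale c (to_quot v) = to_quot (c *: v).
Proof.
by apply/to_quotP; rewrite -scalerBr; apply: subspaceZ; apply: quot_repr_to_quot.
Qed.

Fact quot_scaleA (a b : K) (q : quotient_space) :
  quot_scale a (quot_scale b q) = quot_scale (a * b) q.
Proof. by elim/quot_ind: q => v; rewrite !quot_scale_to_quot scalerA. Qed.

Fact quot_scale1 : left_id 1 quot_scale.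
Proof. by elim/quot_ind=> v; rewrite quot_scale_to_quot scale1r. Qed.

Fact quot_scaleDr : right_distributive quot_scale +%R.
Proof.
move=> a; elim/quot_ind=> u; elim/quot_ind=> v.
by rewrite -to_quotD !quot_scale_to_quot scalerDr to_quotD.
Qed.

Fact quot_scaleDl (q : quotient_space) : {morph quot_scale^~ q : a b / a + b}.
Proof.
by move=> a b; elim/quot_ind: q => v; rewrite !quot_scale_to_quot scalerDl to_quotD.
Qed.

HB.instance Definition _ := GRing.Zmodule_isLmodule.Build K quotient_space
  quot_scaleA quot_scale1 quot_scaleDr quot_scaleDl.

Fact to_quot_is_linear : linear to_quot.
Proof. by move=> c u v; rewrite to_quotD -quot_scale_to_quot. Qed.
HB.instance Definition _ :=
  GRing.isLinear.Build K V quotient_space *:%R to_quot to_quot_is_linear.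

Lemma to_quot_eq0 (v : V) : to_quot v = 0 <-> W v.
Proof. by rewrite -to_quot0 to_quotP subr0. Qed.
End SubspaceTheory.

Section Span.
Variables (K : fieldType) (V : lmodType K).

Definition is_subspace (W : set V) :=
  W 0 /\ forall (c : K) (u v : V), W u -> W v -> W (c *: u + v).

Definition span_set (S : set V) : set V := smallest is_subspace S.

Lemma span_set0 (S : set V) : span_set S 0.
Proof. by move=> W [[W0 _] _]. Qed.

Lemma span_setP (S : set V) (c : K) (u v : V) :
  span_set S u -> span_set S v -> span_set S (c *: u + v).
Proof.
by move=> Su Sv W WS; case: (WS) => -[_ WP] _; apply: WP; [apply: Su|apply: Sv].
Qed.

Definition span (S : set V) : subspace V := Subspace (@span_set0 S) (@span_setP S).

Lemma sub_span (S : set V) (v : V) : S v -> span S v.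
Proof. by move=> Sv W [_]; apply. Qed.

Lemma span_min (S : set V) (W : subspace V) :
  (forall v, S v -> W v) -> forall v, span S v -> W v.
Proof.
move=> SW v; apply; split; last exact: SW.
by split; [apply: subspace0|apply: subspaceP].
Qed.

(* [has_dim P n] : the set P is a vector subspace of dimension n *)
Definition has_dim (P : V -> Prop) (n : nat) : Prop :=
  exists b : 'I_n -> V,
    (forall v, P v <-> exists c : 'I_n -> K, v = \sum_i c i *: b i) /\
    (forall c : 'I_n -> K, \sum_i c i *: b i = 0 -> forall i, c i = 0).

Definition finite_dim (P : V -> Prop) : Prop := exists n, has_dim P n.

Definition countable_dim : Prop := exists e : nat -> V, forall v, span (range e) v.

Definition lin_indep (B : set V) : Prop :=
  forall (s : seq V) (c : V -> K), uniq s -> {in s, forall b, B b} ->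
    \sum_(b <- s) c b *: b = 0 -> {in s, forall b, c b = 0}.

Definition add_monoid (B : set V) : set V :=
  [set v | exists2 s : seq V, {in s, forall b, B b} & v = \sum_(b <- s) b].
End Span.

Section Dual.
Variables (K : fieldType) (V : lmodType K).

Fact dual0 : linear (0 : V -> K^o).
Proof. by move=> c u v /=; rewrite scaler0 addr0. Qed.

Fact dualP (c : K) (f g : V -> K^o) :
  linear f -> linear g -> linear (c *: f + g : V -> K^o).
Proof.
move=> lf lg a u v; rewrite /= [LHS]/(c *: f (a *: u + v) + g (a *: u + v)) lf lg.
rewrite [RHS]/(a *: (c *: f u + g u) + (c *: f v + g v)).
rewrite !scalerDr !scalerA [c * a]mulrC.
exact: (@addrACA K^o).
Qed.

Definition dual_space : subspace (V -> K^o) :=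
  @Subspace K (V -> K^o) (fun f => linear f) dual0 dualP.

Definition dual : Type := subspace_type dual_space.
HB.instance Definition _ := GRing.Lmodule.on dual.

Definition dual_fun (f : dual) : V -> K^o := val f.

Lemma dual_fun_linear (f : dual) : linear (dual_fun f).
Proof. exact: (@subspace_valP _ _ dual_space f). Qed.
HB.instance Definition _ (f : dual) :=
  GRing.isLinear.Build K V K^o *:%R (dual_fun f) (dual_fun_linear f).

Definition to_dual (f : V -> K^o) (lf : linear f) : dual :=
  @in_sub K (V -> K^o) dual_space f lf.
End Dual.
Coercion dual_fun : dual >-> Funclass.

(* {malg K[X]} is the vector space with basis X; [free_ext f] is the linear map
   sending the basis vector << x >> to f x. *)
Section FreeExtension.
Variables (K : fieldType) (X : choiceType) (V : lmodType K).

Definition free_ext (f : X -> V) (w : {malg K[X]}) : V :=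
  \sum_(x <- msupp w) w@_x *: f x.

Lemma free_extEw (f : X -> V) (w : {malg K[X]}) (d : {fset X}) :
  (msupp w `<=` d)%fset -> free_ext f w = \sum_(x <- d) w@_x *: f x.
Proof.
move=> wd; rewrite /free_ext (big_fset_incl _ wd) //= => x _ /mcoeff_outdom ->.
by rewrite scale0r.
Qed.

Fact free_ext_is_linear (f : X -> V) : linear (free_ext f).
Proof.
move=> c u v; pose d := (msupp u `|` (msupp v `|` msupp (c *: u + v)))%fset.
have du : (msupp u `<=` d)%fset by rewrite fsubsetUl.
have dv : (msupp v `<=` d)%fset by rewrite fsubsetU // fsubsetUl orbT.
have dw : (msupp (c *: u + v) `<=` d)%fset by rewrite fsubsetU // fsubsetUr orbT.
rewrite (free_extEw f du) (free_extEw f dv) (free_extEw f dw).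
rewrite scaler_sumr -big_split /=; apply: eq_bigr => x _.
by rewrite mcoeffD mcoeffZ scalerDl scalerA.
Qed.
HB.instance Definition _ (f : X -> V) :=
  GRing.isLinear.Build K {malg K[X]} V *:%R (free_ext f) (free_ext_is_linear f).

Lemma free_ext_basis (f : X -> V) (x : X) : free_ext f << x >> = f x.
Proof. by rewrite /free_ext msuppU oner_eq0 big_seq_fset1 mcoeffUU scale1r. Qed.
End FreeExtension.

Lemma malg_ind (K : fieldType) (X : choiceType) (W : subspace {malg K[X]}) :
  (forall x, W << x >>) -> forall w, W w.
Proof.
move=> Wx w; rewrite (monalgE w); elim: (enum_fset _) => [|x s IHs].
  by rewrite big_nil; apply: subspace0.
rewrite big_cons; apply: subspaceD => //.
have -> : << w@_x *g x >> = w@_x *: << x >> :> {malg K[X]}.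
  by apply/malgP => y; rewrite mcoeffZ !mcoeffU mulrnAr mulr1.
exact: subspaceZ.
Qed.

Lemma malg_mulDl (K : fieldType) (X : monomType) (u v w : {malg K[X]}) :
  (u + v) * w = u * w + v * w.
Proof. exact: mulrDl. Qed.

Lemma malg_mulDr (K : fieldType) (X : monomType) (u v w : {malg K[X]}) :
  u * (v + w) = u * v + u * w.
Proof. exact: mulrDr. Qed.

Lemma malg_scaleAl (K : fieldType) (X : monomType) (c : K) (u v : {malg K[X]}) :
  c *: (u * v) = (c *: u) * v.
Proof. exact: scalerAl. Qed.

Lemma malg_scaleAr (K : fieldType) (X : monomType) (c : K) (u v : {malg K[X]}) :
  c *: (u * v) = u * (c *: v).
Proof.
have comC : u * c%:MP = c%:MP * u.
  by rewrite mul_malgC malgM_def fgmulgU; apply: eq_bigr => k _; rewrite mulm1 mulrC.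
by rewrite -(mul_malgC c (u * v)) -(mul_malgC c v) (mulrA _ u) (mulrA u) comC.
Qed.

HB.mixin Record Lmodule_isLie (K : fieldType) (g : Type) of GRing.Lmodule K g := {
  lie : g -> g -> g;
  lie_linearl : forall y : g, linear (lie^~ y);
  lie_linearr : forall x : g, linear (lie x);
  liexx : forall x : g, lie x x = 0;
  lie_jacobi : forall x y z : g,
    lie x (lie y z) + lie y (lie z x) + lie z (lie x y) = 0
}.
#[short(type="lieType")]
HB.structure Definition LieAlgebra (K : fieldType) :=
  {g of Lmodule_isLie K g & GRing.Lmodule K g}.

Notation "[lie x , y ]" := (lie x y) (at level 0, x, y at level 99,
  format "[lie  x ,  y ]") : ring_scope.

Section LieTheory.
Variables (K : fieldType) (g : lieType K).
Implicit Types x y z : g.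

Lemma lieDl x y z : [lie x + y, z] = [lie x, z] + [lie y, z].
Proof. by have := lie_linearl z 1 x y; rewrite !scale1r. Qed.
Lemma lieDr x y z : [lie x, y + z] = [lie x, y] + [lie x, z].
Proof. by have := lie_linearr x 1 y z; rewrite !scale1r. Qed.
Lemma lie0x x : [lie 0, x] = 0.
Proof. by apply: (@addrI _ [lie 0, x]); rewrite -lieDl !addr0. Qed.
Lemma liex0 x : [lie x, 0] = 0.
Proof. by apply: (@addrI _ [lie x, 0]); rewrite -lieDr !addr0. Qed.
Lemma lieZl (c : K) x y : [lie c *: x, y] = c *: [lie x, y].
Proof. by have := lie_linearl y c x 0; rewrite lie0x !addr0. Qed.
Lemma lieZr (c : K) x y : [lie x, c *: y] = c *: [lie x, y].
Proof. by have := lie_linearr x c y 0; rewrite liex0 !addr0. Qed.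
Lemma lieC x y : [lie x, y] = - [lie y, x].
Proof.
have := liexx (x + y); rewrite lieDl !lieDr !liexx add0r addr0.
by move/eqP; rewrite addr_eq0 => /eqP.
Qed.
End LieTheory.

Record subalgebra (K : fieldType) (g : lieType K) := Subalgebra {
  subalg_space :> subspace g;
  subalg_lie : forall x y : g,
    subalg_space x -> subalg_space y -> subalg_space [lie x, y]
}.

Section SubalgebraLie.
Variables (K : fieldType) (g : lieType K) (s : subalgebra g).

Definition subalg_type : Type := subspace_type s.
HB.instance Definition _ := GRing.Lmodule.on subalg_type.

Definition sub_lie (x y : subalg_type) : subalg_type :=
  in_sub (subalg_lie (subspace_valP x) (subspace_valP y)).

Fact sub_lie_linearl (y : subalg_type) : linear (sub_lie^~ y).
Proof. by move=> c u v; apply: val_inj; rewrite /= lieDl lieZl. Qed.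
Fact sub_lie_linearr (x : subalg_type) : linear (sub_lie x).
Proof. by move=> c u v; apply: val_inj; rewrite /= lieDr lieZr. Qed.
Fact sub_liexx (x : subalg_type) : sub_lie x x = 0.
Proof. by apply: val_inj; rewrite /= liexx. Qed.
Fact sub_lie_jacobi (x y z : subalg_type) :
  sub_lie x (sub_lie y z) + sub_lie y (sub_lie z x) + sub_lie z (sub_lie x y) = 0.
Proof. by apply: val_inj; rewrite /= lie_jacobi. Qed.
HB.instance Definition _ := Lmodule_isLie.Build K subalg_type
  sub_lie_linearl sub_lie_linearr sub_liexx sub_lie_jacobi.

Definition subalg_lieType : lieType K := subalg_type.
End SubalgebraLie.
Coercion subalg_lieType : subalgebra >-> LieAlgebra.type.

Section SubalgebraInclusion.
Variables (K : fieldType) (g : lieType K) (s : subalgebra g).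

Definition subalg_val (x : s) : g := val (x : subspace_type s).

Lemma subalg_valP (x : s) : s (subalg_val x).
Proof. exact: (@subspace_valP _ _ s x). Qed.

Lemma subalg_val_inj : injective subalg_val.
Proof. exact: val_inj. Qed.

Fact subalg_val_linear : linear subalg_val.
Proof. by []. Qed.
HB.instance Definition _ :=
  GRing.isLinear.Build K s g *:%R subalg_val subalg_val_linear.

Lemma subalg_val_lie (x y : s) :
  subalg_val [lie x, y] = [lie subalg_val x, subalg_val y].
Proof. by []. Qed.
End SubalgebraInclusion.

Record lieModule (K : fieldType) (g : lieType K) := LieModule {
  lmod_space :> lmodType K;
  lact : g -> lmod_space -> lmod_space;
  lact_linearl : forall v, linear (lact^~ v);
  lact_linearr : forall x, linear (lact x);
  lact_lie : forall x y v, lact [lie x, y] v = lact x (lact y v) - lact y (lact x v)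
}.

Record lieHom (K : fieldType) (g : lieType K) (M N : lieModule g) := LieHom {
  lie_hom :> M -> N;
  lie_hom_linear : linear lie_hom;
  lie_hom_act : forall x v, lie_hom (lact x v) = lact x (lie_hom v)
}.

(* U(g) is the free associative unital algebra on the set g, i.e. the algebra
   with basis the words over g and concatenation as product, modulo the
   two-sided ideal generated by the relations that make x |-> (word x) linear
   and by xy - yx - [x,y].  Dividing by the linear relations alone gives the
   tensor algebra T(g). *)
Section Enveloping.
Variables (K : fieldType) (g : lieType K).

Local Notation free_alg := {malg K[{fmonom g}]}.

Definition letter (x : g) : free_alg := << fmu x >>.

Definition env_relations : set free_alg :=
  [set r | exists (c : K) (x y : g),
     r = letter (c *: x + y) - (c *: letter x + letter y)] `|`
  [set r | exists x y : g,
     r = letter x * letter y - letter y * letter x - letter [lie x, y]].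

Definition is_ideal (I : set free_alg) : Prop :=
  is_subspace I /\ forall a r : free_alg, I r -> I (a * r) /\ I (r * a).

Definition env_ideal_set : set free_alg := smallest is_ideal env_relations.

Lemma env_ideal0 : env_ideal_set 0.
Proof. by move=> I [[[I0 _] _] _]. Qed.

Lemma env_idealP (c : K) (u v : free_alg) :
  env_ideal_set u -> env_ideal_set v -> env_ideal_set (c *: u + v).
Proof.
move=> Iu Iv I HI; case: (HI) => -[[_ IP] _] _.
by apply: IP; [apply: Iu|apply: Iv].
Qed.

Definition env_ideal : subspace free_alg := Subspace env_ideal0 env_idealP.

Lemma env_idealMl (a r : free_alg) : env_ideal r -> env_ideal (a * r).
Proof. by move=> Ir I HI; case: (HI) => -[_ IM] _; apply: (IM a r (Ir I HI)).1. Qed.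

Lemma env_idealMr (a r : free_alg) : env_ideal r -> env_ideal (r * a).
Proof. by move=> Ir I HI; case: (HI) => -[_ IM] _; apply: (IM a r (Ir I HI)).2. Qed.

Lemma env_ideal_rel (r : free_alg) : env_relations r -> env_ideal r.
Proof. by move=> rr I [_]; apply. Qed.

Lemma env_ideal_min (I : subspace free_alg) :
  (forall a r : free_alg, I r -> I (a * r) /\ I (r * a)) ->
  (forall r, env_relations r -> I r) -> forall r, env_ideal r -> I r.
Proof.
move=> IM Irel r; apply; split; last exact: Irel.
by split; first by split; [apply: subspace0|apply: subspaceP].
Qed.

Definition env_alg : Type := quotient_space env_ideal.
HB.instance Definition _ := GRing.Lmodule.on env_alg.

Definition to_env (w : free_alg) : env_alg := to_quot env_ideal w.
Fact to_env_is_linear : linear to_env.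
Proof. exact: to_quot_is_linear. Qed.
HB.instance Definition _ :=
  GRing.isLinear.Build K free_alg env_alg *:%R to_env to_env_is_linear.

Lemma env_ind (P : env_alg -> Prop) : (forall w, P (to_env w)) -> forall u, P u.
Proof. exact: quot_ind. Qed.

Definition env_mul (u v : env_alg) : env_alg :=
  to_env (quot_repr u * quot_repr v).

Lemma env_mulE (u v : free_alg) :
  env_mul (to_env u) (to_env v) = to_env (u * v).
Proof.
apply/to_quotP; set u' := quot_repr _; set v' := quot_repr _.
have -> : u' * v' - u * v = (u' - u) * v' + u * (v' - v).
  by rewrite mulrBl mulrBr addrA subrK.
by apply: subspaceD; [apply: env_idealMr|apply: env_idealMl]; apply: quot_repr_to_quot.
Qed.

Fact env_mulA : associative env_mul.
Proof.
by elim/env_ind=> u; elim/env_ind=> v; elim/env_ind=> w; rewrite !env_mulE mulrA.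
Qed.
Fact env_mul1 : left_id (to_env 1) env_mul.
Proof. by elim/env_ind=> u; rewrite env_mulE mul1r. Qed.
Fact env_mulr1 : right_id (to_env 1) env_mul.
Proof. by elim/env_ind=> u; rewrite env_mulE mulr1. Qed.
Fact env_mulDl : left_distributive env_mul +%R.
Proof.
elim/env_ind=> u; elim/env_ind=> v; elim/env_ind=> w.
by rewrite -linearD !env_mulE mulrDl linearD.
Qed.
Fact env_mulDr : right_distributive env_mul +%R.
Proof.
elim/env_ind=> u; elim/env_ind=> v; elim/env_ind=> w.
by rewrite -linearD !env_mulE mulrDr linearD.
Qed.

Lemma env_ideal_coef1 (r : free_alg) : env_ideal r -> r@_mone = 0.
Proof.
have coef_letter (x : g) : (letter x)@_mone = 0.
  by rewrite /letter mcoeffU1 -val_eqE /= fmuE fm1.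
have coefM (u v : free_alg) : (u * v)@_mone = u@_mone * v@_mone.
  by have [] := mcoeff1g_is_multiplicative {fmonom g} K.
have I0 : (0 : free_alg)@_mone = 0 by exact: mcoeff0.
have IP (c : K) (u v : free_alg) :
    u@_mone = 0 -> v@_mone = 0 -> (c *: u + v)@_mone = 0.
  by move=> u0 v0; rewrite mcoeffD mcoeffZ u0 v0 mulr0 addr0.
apply: (@env_ideal_min (Subspace I0 IP)) => [a {}r /= r0|{}r [[c [x [y ->]]]|[x [y ->]]]].
- split; first by change ((a * r)@_mone = 0); rewrite coefM r0 mulr0.
  by change ((r * a)@_mone = 0); rewrite coefM r0 mul0r.
- by rewrite /= mcoeffB mcoeffD mcoeffZ !coef_letter mulr0 addr0 subr0.
- change ((letter x * letter y - letter y * letter x - letter [lie x, y])@_mone = 0).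
  move: (letter x) (letter y) (coef_letter x) (coef_letter y) => u v u0 v0.
  by rewrite mcoeffB coef_letter subr0 mcoeffB coefM u0 mul0r coefM v0 mul0r subr0.
Qed.

Fact env_one_neq0 : to_env 1 != 0.
Proof.
apply/eqP => /to_quot_eq0 /env_ideal_coef1 /eqP.
by rewrite mcoeff1 eqxx oner_eq0.
Qed.

HB.instance Definition _ := GRing.Zmodule_isNzRing.Build env_alg
  env_mulA env_mul1 env_mulr1 env_mulDl env_mulDr env_one_neq0.

Lemma env_mulM (u v : free_alg) :
  to_env u * to_env v = to_env (u * v).
Proof. exact: env_mulE. Qed.

Lemma env_scaleE (c : K) (u : free_alg) :
  c *: to_env u = to_env (c *: u).
Proof. by rewrite linearZ. Qed.

Fact env_scaleAl (c : K) (u v : env_alg) : c *: (u * v) = (c *: u) * v.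
Proof.
elim/env_ind: u => u; elim/env_ind: v => v.
by rewrite env_scaleE !env_mulM env_scaleE scalerAl.
Qed.
HB.instance Definition _ := GRing.Lmodule_isLalgebra.Build K env_alg env_scaleAl.

Fact env_scaleAr (c : K) (u v : env_alg) : c *: (u * v) = u * (c *: v).
Proof.
elim/env_ind: u => u; elim/env_ind: v => v.
rewrite env_scaleE !env_mulM env_scaleE; congr (to_env _).
exact: malg_scaleAr.
Qed.
HB.instance Definition _ := GRing.Lalgebra_isAlgebra.Build K env_alg env_scaleAr.

Definition env_inj (x : g) : env_alg := to_env (letter x).

Fact env_inj_linear : linear env_inj.
Proof.
move=> c x y; rewrite /env_inj -linearP; apply/to_quotP; apply: env_ideal_rel.
by left; exists c, x, y.
Qed.
HB.instance Definition _ :=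
  GRing.isLinear.Build K g env_alg *:%R env_inj env_inj_linear.

Lemma env_inj_lie (x y : g) :
  env_inj [lie x, y] = env_inj x * env_inj y - env_inj y * env_inj x.
Proof.
rewrite /env_inj !env_mulM -linearB; apply/esym/to_quotP; apply: env_ideal_rel.
by right; exists x, y.
Qed.
End Enveloping.

(* When f is linear and f [x, y] = f x * f y - f y * f x, [env_lift f] is the
   algebra morphism U(g) -> A extending f. *)
Section EnvelopingLift.
Variables (K : fieldType) (g : lieType K) (A : algType K) (f : g -> A).
Local Notation free_alg := {malg K[{fmonom g}]}.

Definition word_lift (w : free_alg) : A :=
  free_ext (fun m : {fmonom g} => \prod_(x <- m) f x) w.

Definition env_lift (u : env_alg g) : A := word_lift (quot_repr u).

Hypothesis f_lin : linear f.
Hypothesis f_lie : forall x y, f [lie x, y] = f x * f y - f y * f x.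

Lemma word_lift_letter (x : g) : word_lift (letter x) = f x.
Proof. by rewrite /word_lift free_ext_basis fmuE big_seq1. Qed.

Lemma word_lift_linear : linear word_lift.
Proof. by move=> c u v; rewrite /word_lift linearP. Qed.

Lemma word_liftB (u v : free_alg) : word_lift (u - v) = word_lift u - word_lift v.
Proof. by rewrite /word_lift linearB. Qed.

Lemma word_lift_comb (c : K) (p q : free_alg) (P Q S : A) :
  word_lift p = P -> word_lift q = Q -> S = c *: P + Q ->
  word_lift (c *: p + q) = S.
Proof. by move=> pP qQ ->; rewrite word_lift_linear pP qQ. Qed.

Lemma word_lift_rel (p q z : free_alg) (P Q : A) :
  word_lift p = P -> word_lift q = Q -> word_lift z = P - Q ->
  word_lift (p - q - z) = 0.
Proof. by move=> pP qQ zZ; rewrite !word_liftB pP qQ zZ subrr. Qed.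

Lemma word_liftM (u v : free_alg) : word_lift (u * v) = word_lift u * word_lift v.
Proof.
pose W1 := fun u => forall v, word_lift (u * v) = word_lift u * word_lift v.
have lin0 : word_lift 0 = 0 by rewrite /word_lift linear0.
have W10 : W1 0 by move=> w; rewrite mul0r lin0 mul0r.
have W1P (c : K) (a b : free_alg) : W1 a -> W1 b -> W1 (c *: a + b).
  move=> Wa Wb w; rewrite (malg_mulDl (c *: a) b w) -(malg_scaleAl c a w).
  by apply: (word_lift_comb (Wa w) (Wb w)); rewrite word_lift_linear mulrDl scalerAl.
apply: (@malg_ind _ _ (Subspace W10 W1P)) => m {}v /=.
pose W2 v := word_lift (<< m >> * v) = word_lift << m >> * word_lift v.
have W20 : W2 0 by rewrite /W2 mulr0 lin0 mulr0.
have W2P (c : K) (a b : free_alg) : W2 a -> W2 b -> W2 (c *: a + b).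
  rewrite /W2 => Wa Wb; rewrite (malg_mulDr << m >> (c *: a) b) -(malg_scaleAr c << m >> a).
  by apply: (word_lift_comb Wa Wb); rewrite word_lift_linear mulrDr scalerAr.
apply: (@malg_ind _ _ (Subspace W20 W2P)) => m' /=; rewrite /W2.
rewrite malgM_def fgmulUU mulr1 /word_lift !free_ext_basis.
by rewrite [mmul _ _]fmmulE big_cat.
Qed.

Lemma word_lift_ideal (r : free_alg) : env_ideal g r -> word_lift r = 0.
Proof.
have W0 : word_lift 0 = 0 by rewrite /word_lift linear0.
have WP (c : K) (u v : free_alg) :
    word_lift u = 0 -> word_lift v = 0 -> word_lift (c *: u + v) = 0.
  by move=> u0 v0; rewrite word_lift_linear u0 v0 scaler0 addr0.
apply: (@env_ideal_min _ _ (Subspace W0 WP)) => [a {}r r0|{}r [[c [x [y ->]]]|[x [y ->]]]].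
- split; first by change (word_lift (a * r) = 0); rewrite word_liftM r0 mulr0.
  by change (word_lift (r * a) = 0); rewrite word_liftM r0 mul0r.
- change (word_lift (letter (c *: x + y) - (c *: letter x + letter y)) = 0).
  by rewrite word_liftB word_lift_linear !word_lift_letter f_lin subrr.
- apply: word_lift_rel (word_liftM _ _) (word_liftM _ _) _.
  by rewrite !word_lift_letter f_lie.
Qed.

Lemma env_lift_to_env (w : free_alg) : env_lift (to_env w) = word_lift w.
Proof.
apply/eqP; rewrite -subr_eq0 /env_lift -word_liftB.
by apply/eqP/word_lift_ideal/quot_repr_to_quot.
Qed.

Lemma env_lift_inj (x : g) : env_lift (env_inj x) = f x.
Proof. by rewrite env_lift_to_env word_lift_letter. Qed.

Lemma env_lift_linear : linear env_lift.
Proof.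
move=> c; elim/env_ind=> u; elim/env_ind=> v.
by rewrite -linearP !env_lift_to_env word_lift_linear.
Qed.

Lemma env_liftM : {morph env_lift : u v / u * v}.
Proof.
elim/env_ind=> u; elim/env_ind=> v.
by rewrite env_mulM !env_lift_to_env word_liftM.
Qed.

Lemma env_lift1 : env_lift 1 = 1.
Proof.
by rewrite env_lift_to_env /word_lift free_ext_basis [mone]fmoneE big_nil.
Qed.
End EnvelopingLift.

(* U(g) acts on a g-module by (x_1 ... x_n) v = x_1 (... (x_n v)). *)
Section EnvelopingAction.
Variables (K : fieldType) (g : lieType K) (M : lieModule g).
Local Notation free_alg := {malg K[{fmonom g}]}.

Definition word_act (w : free_alg) (v : M) : M :=
  free_ext (fun m : {fmonom g} => foldr (fun x u => lact x u) v m) w.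

Definition env_act (u : env_alg g) (v : M) : M := word_act (quot_repr u) v.

Lemma word_act_letter (x : g) (v : M) : word_act (letter x) v = lact x v.
Proof. by rewrite /word_act free_ext_basis fmuE. Qed.

Lemma word_act_linearl (v : M) : linear (word_act^~ v).
Proof. by move=> c u w; rewrite /word_act linearP. Qed.

Lemma word_act_linearr (w : free_alg) : linear (word_act w).
Proof.
move=> c u v; rewrite /word_act /free_ext scaler_sumr -big_split /=.
apply: eq_bigr => m _; rewrite scalerA mulrC -scalerA -scalerDr; congr (_ *: _).
by elim: (fmonom_val m) => //= x s ->; rewrite lact_linearr.
Qed.

Lemma word_act0 (v : M) : word_act 0 v = 0.
Proof. by rewrite /word_act linear0. Qed.

Lemma word_actB (a b : free_alg) (v : M) :
  word_act (a - b) v = word_act a v - word_act b v.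
Proof. by rewrite /word_act linearB. Qed.

Lemma word_act_comb (c : K) (p q : free_alg) (v P Q S : M) :
  word_act p v = P -> word_act q v = Q -> S = c *: P + Q ->
  word_act (c *: p + q) v = S.
Proof. by move=> pP qQ ->; rewrite word_act_linearl pP qQ. Qed.

Lemma word_act_rel (p q z : free_alg) (v P Q : M) :
  word_act p v = P -> word_act q v = Q -> word_act z v = P - Q ->
  word_act (p - q - z) v = 0.
Proof. by move=> pP qQ zZ; rewrite !word_actB pP qQ zZ subrr. Qed.

Lemma word_actM (u w : free_alg) (v : M) :
  word_act (u * w) v = word_act u (word_act w v).
Proof.
have actr0 a : word_act a 0 = 0.
  by have := word_act_linearr a 1 0 0; rewrite !scale1r addr0 -[LHS]addr0 => /addrI.
pose W1 := fun u => forall w, word_act (u * w) v = word_act u (word_act w v).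
have W10 : W1 0 by move=> a; rewrite mul0r !word_act0.
have W1P (c : K) (a b : free_alg) : W1 a -> W1 b -> W1 (c *: a + b).
  move=> Wa Wb d; rewrite (malg_mulDl (c *: a) b d) -(malg_scaleAl c a d).
  by apply: (word_act_comb (Wa d) (Wb d)); rewrite word_act_linearl.
apply: (@malg_ind _ _ (Subspace W10 W1P)) => m {}w /=.
pose W2 w := word_act (<< m >> * w) v = word_act << m >> (word_act w v).
have W20 : W2 0 by rewrite /W2 mulr0 !word_act0 actr0.
have W2P (c : K) (a b : free_alg) : W2 a -> W2 b -> W2 (c *: a + b).
  rewrite /W2 => Wa Wb; rewrite (malg_mulDr << m >> (c *: a) b) -(malg_scaleAr c << m >> a).
  by apply: (word_act_comb Wa Wb); rewrite word_act_linearl word_act_linearr.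
apply: (@malg_ind _ _ (Subspace W20 W2P)) => m' /=; rewrite /W2.
rewrite malgM_def fgmulUU mulr1 /word_act !free_ext_basis.
by rewrite [mmul _ _]fmmulE /= foldr_cat.
Qed.

Lemma word_act_ideal (r : free_alg) (v : M) : env_ideal g r -> word_act r v = 0.
Proof.
move=> Ir; move: r Ir v.
have W0 v : word_act 0 v = 0 by rewrite word_act0.
have WP (c : K) (a b : free_alg) :
    (forall v, word_act a v = 0) -> (forall v, word_act b v = 0) ->
    forall v, word_act (c *: a + b) v = 0.
  by move=> a0 b0 v; rewrite word_act_linearl a0 b0 scaler0 addr0.
apply: (@env_ideal_min _ _ (@Subspace _ _ (fun r => forall v, word_act r v = 0) W0 WP))
  => [a r r0|r [[c [x [y ->]]]|[x [y ->]]] v].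
- split=> v; first by change (word_act (a * r) v = 0);
  rewrite word_actM r0 -(word_act0 0) -word_actM mulr0.
  by change (word_act (r * a) v = 0); rewrite word_actM r0.
- change (word_act (letter (c *: x + y) - (c *: letter x + letter y)) v = 0).
  by rewrite word_actB word_act_linearl !word_act_letter lact_linearl subrr.
- apply: word_act_rel (word_actM _ _ _) (word_actM _ _ _) _.
  by rewrite !word_act_letter lact_lie.
Qed.

Lemma env_act_to_env (w : free_alg) (v : M) : env_act (to_env w) v = word_act w v.
Proof.
apply/eqP; rewrite -subr_eq0 /env_act -word_actB.
by apply/eqP/word_act_ideal/quot_repr_to_quot.
Qed.

Lemma env_act_inj (x : g) (v : M) : env_act (env_inj x) v = lact x v.
Proof. by rewrite env_act_to_env word_act_letter. Qed.

Lemma env_act1 (v : M) : env_act 1 v = v.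
Proof. by rewrite env_act_to_env /word_act free_ext_basis [mone]fmoneE. Qed.

Lemma env_actM (a b : env_alg g) (v : M) : env_act (a * b) v = env_act a (env_act b v).
Proof.
elim/env_ind: a => a; elim/env_ind: b => b.
by rewrite env_mulM !env_act_to_env word_actM.
Qed.

Lemma env_act_linearl (v : M) : linear (env_act^~ v).
Proof.
move=> c; elim/env_ind=> a; elim/env_ind=> b.
by rewrite -linearP !env_act_to_env word_act_linearl.
Qed.

Lemma env_act_linearr (a : env_alg g) : linear (env_act a).
Proof. exact: word_act_linearr. Qed.
End EnvelopingAction.

Lemma comb_swap (K : fieldType) (V : lmodType K) (a c : K) (p q r s : V) :
  c *: (a *: p + q) + (a *: r + s) = a *: (c *: p + r) + (c *: q + s).
Proof. by rewrite !scalerDr !scalerA [a * c]mulrC addrACA. Qed.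

Lemma comb_sub (K : fieldType) (V : lmodType K) (a : K) (p q r s : V) :
  a *: p + q - (a *: r + s) = a *: (p - r) + (q - s).
Proof. by rewrite scalerBr opprD addrACA. Qed.

(* P (x)_A L for a right A-module P and a left A-module L, whose actions are
   [ra] and [la]: the vector space with basis P x L modulo the span of the
   bilinearity relations and of (p a, l) - (p, a l). *)
Section Tensor.
Variables (K : fieldType) (A : Type) (P L : lmodType K).
Variables (ra : P -> A -> P) (la : A -> L -> L).

Local Notation free_vect := {malg K[(P * L)%type]}.
Local Notation pair_vect p l := (<< (p, l) >> : free_vect).

Definition tensor_relations : set free_vect :=
  [set r | exists (c : K) (p p' : P) (l : L),
     r = pair_vect (c *: p + p') l - (c *: pair_vect p l + pair_vect p' l)] `|`
  [set r | exists (c : K) (p : P) (l l' : L),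
     r = pair_vect p (c *: l + l') - (c *: pair_vect p l + pair_vect p l')] `|`
  [set r | exists (p : P) (a : A) (l : L),
     r = pair_vect (ra p a) l - pair_vect p (la a l)].

Definition tensor : Type := quotient_space (span tensor_relations).
HB.instance Definition _ := GRing.Lmodule.on tensor.

Definition to_tensor (w : free_vect) : tensor := to_quot (span tensor_relations) w.
Fact to_tensor_is_linear : linear to_tensor.
Proof. exact: to_quot_is_linear. Qed.
HB.instance Definition _ :=
  GRing.isLinear.Build K free_vect tensor *:%R to_tensor to_tensor_is_linear.

Definition tens (p : P) (l : L) : tensor := to_tensor (pair_vect p l).

Lemma tens_linearl (l : L) : linear (tens^~ l).
Proof.
move=> c p p'; rewrite /tens -linearP; apply/to_quotP; apply: sub_span.
by left; left; exists c, p, p', l.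
Qed.

Lemma tens_linearr (p : P) : linear (tens p).
Proof.
move=> c l l'; rewrite /tens -linearP; apply/to_quotP; apply: sub_span.
by left; right; exists c, p, l, l'.
Qed.

Lemma tens_balanced (p : P) (a : A) (l : L) : tens (ra p a) l = tens p (la a l).
Proof.
by apply/to_quotP; apply: sub_span; right; exists p, a, l.
Qed.

Lemma tensor_ind (W : subspace tensor) :
  (forall p l, W (tens p l)) -> forall t, W t.
Proof.
move=> Wt; apply: quot_ind.
have W0 : W (to_tensor 0) by rewrite linear0; apply: subspace0.
have WP (c : K) (u v : free_vect) :
    W (to_tensor u) -> W (to_tensor v) -> W (to_tensor (c *: u + v)).
  by move=> Wu Wv; rewrite linearP; apply: subspaceP.
apply: (@malg_ind _ _ (@Subspace _ _ (fun w => W (to_tensor w)) W0 WP)) => -[p l].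
exact: Wt.
Qed.

Lemma tensor_ext (V : lmodType K) (F G : tensor -> V) :
  linear F -> linear G -> (forall p l, F (tens p l) = G (tens p l)) ->
  forall t, F t = G t.
Proof.
move=> lF lG FG.
have l0 (H : tensor -> V) : linear H -> H 0 = 0.
  by move=> lH; have := lH 1 0 0; rewrite !scale1r addr0 -[LHS]addr0 => /addrI.
have E0 : F 0 = G 0 by rewrite !l0.
have EP (c : K) (u v : tensor) : F u = G u -> F v = G v -> F (c *: u + v) = G (c *: u + v).
  by move=> hu hv; rewrite lF lG hu hv.
exact: (@tensor_ind (@Subspace _ _ (fun t => F t = G t) E0 EP)).
Qed.

Section Lift.
Variables (V : lmodType K) (f : P -> L -> V).

Definition tensor_lift (t : tensor) : V :=
  free_ext (fun x : P * L => f x.1 x.2) (quot_repr t).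

Hypothesis f_linl : forall l, linear (f^~ l).
Hypothesis f_linr : forall p, linear (f p).
Hypothesis f_bal : forall p a l, f (ra p a) l = f p (la a l).

Lemma tensor_lift_to_tensor (w : free_vect) :
  tensor_lift (to_tensor w) = free_ext (fun x : P * L => f x.1 x.2) w.
Proof.
apply/eqP; rewrite -subr_eq0 /tensor_lift -linearB /=; apply/eqP.
set F := free_ext _.
have FB u v : F (u - v) = F u - F v by rewrite /F linearB.
have FP c u v : F (c *: u + v) = c *: F u + F v by rewrite /F linearP.
have FE p l : F (pair_vect p l) = f p l by rewrite /F free_ext_basis.
have F0 : F 0 = 0 by rewrite /F linear0.
have F0P (c : K) (u v : free_vect) : F u = 0 -> F v = 0 -> F (c *: u + v) = 0.
  by move=> u0 v0; rewrite FP u0 v0 scaler0 addr0.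
have := @quot_repr_to_quot _ _ (span tensor_relations) w.
move: (_ - w); apply: (@span_min _ _ _ (@Subspace _ _ (fun w => F w = 0) F0 F0P)).
move=> r [[[c [p [p' [l ->]]]]|[c [p [l [l' ->]]]]]|[p [a [l ->]]]].
- by rewrite /= FB FP !FE f_linl subrr.
- by rewrite /= FB FP !FE f_linr subrr.
- by rewrite /= FB !FE f_bal subrr.
Qed.

Lemma tensor_lift_tens (p : P) (l : L) : tensor_lift (tens p l) = f p l.
Proof. by rewrite tensor_lift_to_tensor free_ext_basis. Qed.

Lemma tensor_lift_linear : linear tensor_lift.
Proof.
move=> c; elim/quot_ind=> u; elim/quot_ind=> v.
rewrite -[to_quot _ u]/(to_tensor u) -[to_quot _ v]/(to_tensor v) -linearP.
by rewrite !tensor_lift_to_tensor linearP.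
Qed.
End Lift.
End Tensor.

(* U(g) (x)_{U(s)} M for a subalgebra s of g, with g acting by left
   multiplication; U(s) acts on the right of U(g) through U(s) -> U(g). *)
Section Induced.
Variables (K : fieldType) (g : lieType K) (s : subalgebra g) (M : lieModule s).

Definition env_incl : env_alg s -> env_alg g :=
  env_lift (fun x : s => env_inj (subalg_val x)).

Definition induced_space : Type :=
  tensor (fun (u : env_alg g) (a : env_alg s) => u * env_incl a) (@env_act K s M).
HB.instance Definition _ := GRing.Lmodule.on induced_space.

Definition ind_tens (u : env_alg g) (m : M) : induced_space := tens _ _ u m.

Definition induced_act (x : g) : induced_space -> induced_space :=
  tensor_lift (fun u m => ind_tens (env_inj x * u) m).

Lemma induced_act_tens (x : g) (u : env_alg g) (m : M) :
  induced_act x (ind_tens u m) = ind_tens (env_inj x * u) m.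
Proof.
apply: tensor_lift_tens => [l c p p'|p c l l'|p a l].
- by rewrite mulrDr -scalerAr; apply: tens_linearl.
- exact: tens_linearr.
- by rewrite mulrA; apply: tens_balanced.
Qed.

Fact induced_act_linearr (x : g) : linear (induced_act x).
Proof.
apply: tensor_lift_linear => [l c p p'|p c l l'|p a l].
- by rewrite mulrDr -scalerAr; apply: tens_linearl.
- exact: tens_linearr.
- by rewrite mulrA; apply: tens_balanced.
Qed.

Lemma induced_ext (V : lmodType K) (F G : induced_space -> V) :
  linear F -> linear G -> (forall u m, F (ind_tens u m) = G (ind_tens u m)) ->
  forall t, F t = G t.
Proof. exact: tensor_ext. Qed.

Lemma ind_tens_linearl (m : M) : linear (ind_tens^~ m).
Proof. exact: tens_linearl. Qed.

Lemma ind_tensBl (u v : env_alg g) (m : M) :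
  ind_tens (u - v) m = ind_tens u m - ind_tens v m.
Proof. by have := ind_tens_linearl m (-1) v u; rewrite !scaleN1r ![- _ + _]addrC. Qed.

Fact induced_act_linearl (t : induced_space) : linear (induced_act^~ t).
Proof.
move=> c x y; move: t.
apply: (@induced_ext _ (fun t => induced_act (c *: x + y) t)
          (fun t => c *: induced_act x t + induced_act y t)).
- exact: induced_act_linearr.
- move=> a u v; rewrite (induced_act_linearr x) (induced_act_linearr y).
  exact: comb_swap.
- move=> u m; have -> : induced_act (c *: x + y) (ind_tens u m) =
      ind_tens (c *: (env_inj x * u) + env_inj y * u) m.
    by rewrite induced_act_tens env_inj_linear mulrDl -scalerAl.
  by rewrite ind_tens_linearl !induced_act_tens.
Qed.

Fact induced_act_lie (x y : g) (t : induced_space) :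
  induced_act [lie x, y] t =
    induced_act x (induced_act y t) - induced_act y (induced_act x t).
Proof.
move: t.
apply: (@induced_ext _ (fun t => induced_act [lie x, y] t)
  (fun t => induced_act x (induced_act y t) - induced_act y (induced_act x t))).
- exact: induced_act_linearr.
- by move=> a u v; rewrite !induced_act_linearr; apply: comb_sub.
- move=> u m; apply: etrans (induced_act_tens _ _ _) _; rewrite env_inj_lie mulrBl ind_tensBl.
  by congr (_ - _); rewrite -mulrA -!induced_act_tens.
Qed.

Definition induced : lieModule g :=
  LieModule induced_act_linearl induced_act_linearr induced_act_lie.
End Induced.

(* Lie algebra homomorphisms s -> K for the abelian Lie algebra K, i.e. the
   elements of (s / [s, s])^* *)
Record lieChar (K : fieldType) (s : lieType K) := LieChar {
  char_fun :> dual s;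
  char_lie : forall x y : s, char_fun [lie x, y] = 0
}.

Section CharModule.
Variables (K : fieldType) (s : lieType K) (chi : lieChar s).

Definition char_act (x : s) (c : K^o) : K^o := chi x *: c.

Fact char_act_linearl (c : K^o) : linear (char_act^~ c).
Proof. by move=> a x y; rewrite /char_act linearP scalerDl scalerA. Qed.

Fact char_act_linearr (x : s) : linear (char_act x).
Proof. by move=> a c d; rewrite /char_act scalerDr !scalerA mulrC. Qed.

Fact char_act_lie (x y : s) (c : K^o) :
  char_act [lie x, y] c = char_act x (char_act y c) - char_act y (char_act x c).
Proof. by rewrite /char_act char_lie scale0r !scalerA mulrC subrr. Qed.

Definition char_module : lieModule s :=
  LieModule char_act_linearl char_act_linearr char_act_lie.
End CharModule.

Section DualModule.
Variables (K : fieldType) (g : lieType K) (M : lieModule g).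

Fact dual_act_subproof (x : g) (f : dual M) :
  linear ((fun v => f (- lact x v)) : M -> K^o).
Proof. by move=> c u v; rewrite lact_linearr opprD -scalerN linearP. Qed.

Definition dual_act (x : g) (f : dual M) : dual M := to_dual (dual_act_subproof x f).

Lemma dual_actE (x : g) (f : dual M) (v : M) : dual_act x f v = f (- lact x v).
Proof. by []. Qed.

Lemma dual_eq (f1 f2 : dual M) : (forall v, f1 v = f2 v) -> f1 = f2.
Proof. by move=> f12; apply: val_inj; apply/funext. Qed.

Lemma dual_addE (c : K) (f1 f2 : dual M) (v : M) : dual_fun (c *: f1 + f2) v = c *: f1 v + f2 v.
Proof. by []. Qed.

Lemma dual_subE (f1 f2 : dual M) (v : M) : dual_fun (f1 - f2) v = f1 v - f2 v.
Proof. by []. Qed.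

Fact dual_act_linearl (f : dual M) : linear (dual_act^~ f).
Proof.
move=> c x y; apply: dual_eq => v; rewrite dual_addE !dual_actE lact_linearl.
by rewrite opprD -scalerN linearP.
Qed.

Fact dual_act_linearr (x : g) : linear (dual_act x).
Proof. by move=> c f1 f2; apply: dual_eq => v; rewrite dual_addE !dual_actE dual_addE. Qed.

Fact dual_act_lie (x y : g) (f : dual M) :
  dual_act [lie x, y] f = dual_act x (dual_act y f) - dual_act y (dual_act x f).
Proof.
apply: dual_eq => v; rewrite dual_subE !dual_actE lact_lie.
have lactN z u : lact z (- u) = - lact z u :> M.
  have l0 : lact z 0 = 0 :> M.
    by have := lact_linearr z 1 (0 : M) 0; rewrite !scale1r addr0 -[LHS]addr0 => /addrI.
  by have := lact_linearr z (-1) u 0; rewrite l0 !addr0 !scaleN1r.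
by rewrite !lactN !opprK -linearB opprB.
Qed.

Definition dual_module : lieModule g :=
  @LieModule K g (dual M) dual_act dual_act_linearl dual_act_linearr dual_act_lie.
End DualModule.

Section Submodule.
Variables (K : fieldType) (g : lieType K) (M : lieModule g).

Definition stable (W : subspace M) : Prop := forall (x : g) (v : M), W v -> W (lact x v).

Definition simple_module : Prop :=
  (exists v : M, v <> 0) /\
  forall W : subspace M, stable W -> (forall v, W v -> v = 0) \/ (forall v, W v).

Variables (W : subspace M) (Wst : stable W).

Definition submodule_act (x : g) (v : subspace_type W) : subspace_type W :=
  in_sub (Wst x (subspace_valP v)).

Fact submodule_act_linearl (v : subspace_type W) : linear (submodule_act^~ v).
Proof. by move=> c x y; apply: val_inj; rewrite /= lact_linearl. Qed.

Fact submodule_act_linearr (x : g) : linear (submodule_act x).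
Proof. by move=> c u v; apply: val_inj; rewrite /= lact_linearr. Qed.

Fact submodule_act_lie (x y : g) (v : subspace_type W) :
  submodule_act [lie x, y] v =
    submodule_act x (submodule_act y v) - submodule_act y (submodule_act x v).
Proof. by apply: val_inj; rewrite /= lact_lie. Qed.

Definition submodule : lieModule g :=
  @LieModule K g (subspace_type W) submodule_act
    submodule_act_linearl submodule_act_linearr submodule_act_lie.
End Submodule.

Section Homs.
Variables (K : fieldType) (g : lieType K) (M N : lieModule g).

HB.instance Definition _ := gen_eqMixin (lieHom M N).
HB.instance Definition _ := gen_choiceMixin (lieHom M N).

Fact lie_hom0_linear : linear (fun _ : M => 0 : N).
Proof. by move=> c u v; rewrite scaler0 addr0. Qed.

Fact lie_hom0_act (x : g) (v : M) : (0 : N) = lact x (0 : N).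
Proof.
have := lact_linearr x 1 (0 : N) 0; rewrite !scale1r addr0 => /eqP.
by rewrite -subr_eq0 opprD addNKr oppr_eq0 => /eqP ->.
Qed.

Definition lie_hom0 : lieHom M N := LieHom lie_hom0_linear lie_hom0_act.

Variable f : lieHom M N.

Fact image0 : exists m, 0 = f m.
Proof.
exists 0; have := lie_hom_linear f 1 0 0.
by rewrite !scale1r addr0 -[LHS]addr0 => /addrI.
Qed.

Fact imageP (c : K) (u v : N) :
  (exists m, u = f m) -> (exists m, v = f m) -> exists m, c *: u + v = f m.
Proof. by move=> [m ->] [m' ->]; exists (c *: m + m'); rewrite lie_hom_linear. Qed.

Definition image_space : subspace N :=
  @Subspace K N (fun v => exists m, v = f m) image0 imageP.

Fact image_stable : stable image_space.
Proof. by move=> x _ [m ->]; exists (lact x m); rewrite lie_hom_act. Qed.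

Definition image_module : lieModule g := submodule image_stable.
End Homs.

Section Whittaker.
Variables (K : fieldType) (g : lieType K) (n : subalgebra g) (lambda : lieChar n).

Definition whittaker_vector (M : lieModule g) (v : M) : Prop :=
  forall x : n, lact (subalg_val x) v = lambda x *: v.

Definition standard_whittaker : lieModule g := induced (char_module lambda).
End Whittaker.

Section Weights.
Variables (K : fieldType) (g : lieType K) (h n : subalgebra g).

Definition weight_space (alpha : dual h) : set g :=
  [set x | n x /\ forall a : h, [lie subalg_val a, x] = alpha a *: x].
End Weights.

(* Weight spaces for distinct weights are always linearly independent, so
   [tri_np_weights] says that n_+ is the direct sum of its weight spaces. *)
Record triangular (K : fieldType) (g : lieType K) := Triangular {
  tri_nm : subalgebra g;
  tri_h : subalgebra g;
  tri_np : subalgebra g;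
  tri_decomp : forall x : g, exists! p : tri_nm * tri_h * tri_np,
    x = subalg_val p.1.1 + subalg_val p.1.2 + subalg_val p.2;
  tri_h_neq0 : exists a : tri_h, a <> 0;
  tri_nm_neq0 : exists a : tri_nm, a <> 0;
  tri_np_neq0 : exists a : tri_np, a <> 0;
  tri_h_abelian : forall a b : tri_h, [lie a, b] = 0;
  tri_nm_stable : forall a x : g, tri_h a -> tri_nm x -> tri_nm [lie a, x];
  tri_np_stable : forall a x : g, tri_h a -> tri_np x -> tri_np [lie a, x];
  tri_np_weights : forall x : g, tri_np x ->
    span (\bigcup_alpha weight_space (h := tri_h) tri_np alpha) x;
  tri_weight_finite : forall alpha : dual tri_h,
    finite_dim (weight_space tri_np alpha);
  tri_weights_pos : exists2 B : set (dual tri_h), lin_indep B &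
    forall (alpha : dual tri_h) (x : g), weight_space tri_np alpha x -> x <> 0 ->
      add_monoid B alpha /\ alpha <> 0;
  tri_anti_involution : exists sigma : {linear g -> g},
    [/\ forall x y, sigma [lie x, y] = [lie sigma y, sigma x],
        involutive sigma,
        sigma @` tri_np = tri_nm :> set g &
        forall a, tri_h a -> sigma a = a]
}.

Section LowestVerma.
Variables (K : fieldType) (g : lieType K) (T : triangular g).
Local Notation nm := (tri_nm T).
Local Notation h := (tri_h T).
Local Notation np := (tri_np T).

Lemma tri_sum_uniq (p q : nm * h * np) :
  subalg_val p.1.1 + subalg_val p.1.2 + subalg_val p.2 =
  subalg_val q.1.1 + subalg_val q.1.2 + subalg_val q.2 -> p = q.
Proof.
move=> pq; have [r [_ ru]] := tri_decomp T
  (subalg_val p.1.1 + subalg_val p.1.2 + subalg_val p.2).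
by rewrite -(ru p erefl) -(ru q pq).
Qed.

Definition in_borel (x : g) : Prop :=
  exists (a : h) (b : nm), x = subalg_val a + subalg_val b.

Fact borel0 : in_borel 0.
Proof. by exists 0, 0; rewrite !linear0 addr0. Qed.

Fact borelP (c : K) (x y : g) : in_borel x -> in_borel y -> in_borel (c *: x + y).
Proof.
move=> [a [b ->]] [a' [b' ->]]; exists (c *: a + a'), (c *: b + b').
by rewrite !linearP scalerDr addrACA.
Qed.

Lemma borel_lie_nm (a a' : h) (b b' : nm) :
  nm [lie subalg_val a + subalg_val b, subalg_val a' + subalg_val b'].
Proof.
rewrite lieDl !lieDr -subalg_val_lie tri_h_abelian linear0 add0r -subalg_val_lie.
apply: subspaceD; first by apply: tri_nm_stable; apply: subalg_valP.
apply: subspaceD; last exact: subalg_valP.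
by rewrite lieC; apply: subspaceN; apply: tri_nm_stable; apply: subalg_valP.
Qed.

Fact borel_lie (x y : g) : in_borel x -> in_borel y -> in_borel [lie x, y].
Proof.
move=> [a [b ->]] [a' [b' ->]]; exists 0, (in_sub (borel_lie_nm a a' b b') : nm).
by rewrite linear0 add0r.
Qed.

Definition borel : subalgebra g := @Subalgebra K g (Subspace borel0 borelP) borel_lie.

Lemma borel_hpart (x : borel) :
  exists a : h, exists b : nm, subalg_val x = subalg_val a + subalg_val b.
Proof. exact: (subalg_valP x). Qed.

Definition hpart (x : borel) : h := projT1 (cid (borel_hpart x)).

Lemma hpartP (x : borel) (a : h) (b : nm) :
  subalg_val x = subalg_val a + subalg_val b -> hpart x = a.
Proof.
rewrite /hpart; case: cid => /= a' [b' ->] e.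
suff : (b', a', 0 : np) = (b, a, 0) by case.
by apply: tri_sum_uniq; rewrite /= !linear0 !addr0 addrC e addrC.
Qed.

Variable mu : dual h.

Fact neg_weight_linear : linear ((fun x : borel => - mu (hpart x)) : borel -> K^o).
Proof.
suff comb (c : K) (x y : borel) :
    - mu (hpart (c *: x + y)) = c *: - mu (hpart x) + - mu (hpart y)
  by move=> c x y; apply: comb.
have [a [b ex]] := borel_hpart x; have [a' [b' ey]] := borel_hpart y.
have exy : subalg_val (c *: x + y) = subalg_val (c *: a + a') + subalg_val (c *: b + b').
  apply: etrans (subalg_val_linear c x y) _.
  by rewrite ex ey !linearP scalerDr addrACA.
by rewrite (hpartP ex) (hpartP ey) (hpartP exy) linearP opprD scalerN.
Qed.

Fact neg_weight_lie (x y : borel) : to_dual neg_weight_linear [lie x, y] = 0.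
Proof.
have [a [b ex]] := borel_hpart x; have [a' [b' ey]] := borel_hpart y.
have exy : subalg_val [lie x, y] =
    subalg_val (0 : h) + subalg_val (in_sub (borel_lie_nm a a' b b') : nm).
  by rewrite linear0 add0r; apply: congr2 ex ey.
apply: etrans (congr1 (fun z => - mu z) (hpartP exy)) _.
by apply/eqP; rewrite oppr_eq0 linear0.
Qed.

(* The character a + b |-> - mu a of h + n_- *)
Definition neg_weight : lieChar borel := LieChar neg_weight_lie.

Definition lowest_verma : lieModule g := induced (char_module neg_weight).
End LowestVerma.

Section WhittakerImage.
Variables (K : fieldType) (g : lieType K) (T : triangular g).
Variables (lambda : lieChar (tri_np T)) (mu : dual (tri_h T)).

(* A nonzero homomorphism M_lambda -> N(-mu)^*, which exists and is unique up to
   a nonzero scalar, so that its image L(lambda, mu) does not depend on the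
   choice; [lie_hom0] is only the default value that [xget] requires. *)
Definition whittaker_hom :
    lieHom (standard_whittaker lambda) (dual_module (lowest_verma mu)) :=
  xget (lie_hom0 _ _) [set f | exists m, f m <> 0].

Definition whittaker_image : lieModule g := image_module whittaker_hom.
End WhittakerImage.

(* Main.v *)
(* L(lambda, mu) is generated by the image w of the canonical generator of
   M_lambda, a nonzero element of W_lambda(N(-mu)^* ).

   Such a w exists because N(-mu) maps onto a g-module structure on U(n): let n
   act on Hom(g, U(n)) by (x phi)(z) = x phi(z) + phi([z, x]); the map
   phi_0(z) = z_n + chi(z_b), where g = n + b and chi is the character of the
   Borel subalgebra b, yields the action z u = (u phi_0)(z) of g on U(n), and the
   algebra morphism U(n) -> K extending -lambda is the required functional.  This
   replaces the appeal to the PBW theorem.  W_lambda(N(-mu)^* ) is at most a line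
   because N(-mu) is spanned by the words in n applied to its generator.

   For simplicity, ad n acts locally nilpotently on g / n, since heights of
   weights increase.  As x - lambda x kills w, it acts on a word z_1 ... z_k w as
   the derivation ad x, and a word with a letter in n lies in U(g)_{<k} w.  Hence
   the elements x - lambda x act locally nilpotently on the quotients
   U(g)_{<k+1} w / U(g)_{<k} w, so that any nonzero submodule contains a nonzero
   Whittaker vector, which is a multiple of w. *)
Require Import Defs.
From mathcomp Require Import all_boot all_order all_algebra.
From mathcomp.multinomials Require Import monalg.
From mathcomp Require Import boolp classical_sets functions reals.
From mathcomp.real_closed Require Import complex.

Set Implicit Arguments.
Unset Strict Implicit.
Unset Printing Implicit Defensive.

Import GRing.Theory.

Local Open Scope classical_set_scope.
Local Open Scope ring_scope.

(** * Induction on enveloping algebras and module arithmetic *)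

Lemma env_alg_ind (K : fieldType) (g : lieType K) (P : env_alg g -> Prop) :
  P 1 -> (forall (c : K) u v, P u -> P v -> P (c *: u + v)) ->
  (forall x u, P u -> P (env_inj x * u)) -> forall u, P u.
Proof.
move=> P1 PP PM; apply: env_ind.
(* The value at 0 follows from [P1], since 0 = (-1) 1 + 1. *)
have P0 : P (to_env 0).
  by have := PP (-1) 1 1 P1 P1; rewrite scaleN1r addNr linear0.
have W1 (c : K) (u v : {malg K[{fmonom g}]}) :
    P (to_env u) -> P (to_env v) -> P (to_env (c *: u + v)).
  by move=> Pu Pv; rewrite linearP; apply: PP.
apply: (@malg_ind _ _ (@Subspace _ _ (fun w => P (to_env w)) P0 W1)) => -[s] /=.
elim: s => [|x s IHs].
  by have /= -> : FMonom (@nil g) = mone by apply/eqP; rewrite -val_eqE /= fm1.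
have := PM x _ IHs; rewrite /env_inj env_mulM /letter malgM_def fgmulUU mulr1.
have -> // : mmul (fmu x) (FMonom s) = FMonom (x :: s).
by apply/eqP; rewrite -val_eqE /= fmM fmuE.
Qed.

Section Lact.
Variables (K : fieldType) (g : lieType K) (M : lieModule g).
Implicit Types (x y : g) (u v : M).

Lemma lactDr x u v : lact x (u + v) = lact x u + lact x v.
Proof. by have := lact_linearr x 1 u v; rewrite !scale1r. Qed.

Lemma lact0 x : lact x (0 : M) = 0.
Proof. by apply: (@addrI _ (lact x (0 : M))); rewrite -lactDr !addr0. Qed.

Lemma lactZr x (c : K) v : lact x (c *: v) = c *: lact x v.
Proof. by have := lact_linearr x c v 0; rewrite lact0 !addr0. Qed.

Lemma lactBr x u v : lact x (u - v) = lact x u - lact x v.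
Proof. by rewrite -scaleN1r lactDr lactZr scaleN1r. Qed.

Lemma lactDl x y v : lact (x + y) v = lact x v + lact y v.
Proof. by have := lact_linearl v 1 x y; rewrite !scale1r. Qed.

Lemma lact_comm x y v : lact x (lact y v) = lact [lie x, y] v + lact y (lact x v).
Proof. by rewrite lact_lie subrK. Qed.

Lemma env_act_injM x (a : env_alg g) v :
  env_act (env_inj x * a) v = lact x (env_act a v).
Proof. by rewrite env_actM env_act_inj. Qed.

End Lact.

(** * Universal property of induced modules *)

Section InducedModules.
Variables (K : fieldType) (g : lieType K) (s : subalgebra g) (L : lieModule s).

Lemma lact_ind_tens (x : g) (u : env_alg g) (m : L) :
  lact x (ind_tens u m : induced L) = ind_tens (env_inj x * u) m.
Proof. exact: induced_act_tens. Qed.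

Let incl (x : s) : env_alg g := env_inj (subalg_val x).

Let incl_linear : linear incl.
Proof.
by move=> c y z; apply: etrans (env_inj_linear c _ _); rewrite -subalg_val_linear.
Qed.

Let incl_lie (y z : s) : incl [lie y, z] = incl y * incl z - incl z * incl y.
Proof. by rewrite /incl subalg_val_lie env_inj_lie. Qed.

Lemma env_incl_inj (x : s) : env_incl (env_inj x) = env_inj (subalg_val x).
Proof. exact: (env_lift_inj incl_linear incl_lie). Qed.

Lemma env_inclM (a b : env_alg s) : env_incl (a * b) = env_incl a * env_incl b.
Proof. exact: (env_liftM incl_linear incl_lie). Qed.

Lemma env_incl_linear : linear (@env_incl K g s).
Proof. exact: (env_lift_linear incl_linear incl_lie). Qed.

Lemma env_incl1 : env_incl (1 : env_alg s) = 1.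
Proof. exact: (env_lift1 incl_linear incl_lie). Qed.

Lemma lact_ind_tens1 (x : s) (m : L) :
  lact (subalg_val x) (ind_tens 1 m : induced L) = ind_tens 1 (lact x m).
Proof.
rewrite lact_ind_tens mulr1 -env_act_inj -env_incl_inj -[env_incl _]mul1r.
exact: tens_balanced.
Qed.

Lemma ind_tensZr (u : env_alg g) (c : K) (m : L) :
  ind_tens u (c *: m) = c *: ind_tens u m.
Proof.
have lin (a : K) (l l' : L) : ind_tens u (a *: l + l') = a *: ind_tens u l + ind_tens u l'.
  exact: tens_linearr.
have e0 : ind_tens u (0 : L) = 0.
  by have := lin (-1) 0 0; rewrite scaler0 addr0 scaleN1r addNr.
by have := lin c m 0; rewrite e0 !addr0.
Qed.

Lemma induced_gen (W : subspace (induced L)) :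
  stable W -> (forall m, W (ind_tens 1 m)) -> forall t, W t.
Proof.
move=> Wst W1; apply: tensor_ind => u m; move: u m.
apply: (@env_alg_ind _ _ (fun u => forall m, W (ind_tens u m))) => [|c u v Wu Wv m|x u Wu m].
- exact: W1.
- by rewrite ind_tens_linearl; apply: subspaceP.
- by rewrite -lact_ind_tens; apply: Wst.
Qed.

Variables (M : lieModule g) (phi : L -> M).
Hypothesis phi_lin : linear phi.
Hypothesis phi_act : forall x m, phi (lact x m) = lact (subalg_val x) (phi m).

(** Compatibility with s passes to U(s) by induction on [a]; this is the balance condition that
    makes u (x) m |-> u phi(m) well defined on the tensor product. *)
Lemma env_incl_act (a : env_alg s) (m : L) :
  env_act (env_incl a) (phi m) = phi (env_act a m).
Proof.
move: a m; apply: (@env_alg_ind _ _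
    (fun a => forall m, env_act (env_incl a) (phi m) = phi (env_act a m)))
  => [m|c u v IHu IHv m|x u IHu m].
- by rewrite env_incl1 !env_act1.
- have e1 : env_incl (c *: u + v) = c *: env_incl u + env_incl v := env_incl_linear c u v.
  rewrite e1 (env_act_linearl (phi m) c) (env_act_linearl m c) phi_lin.
  by congr (_ *: _ + _); [apply: IHu|apply: IHv].
- by rewrite env_inclM env_incl_inj env_act_injM IHu env_act_injM phi_act.
Qed.

(** Frobenius reciprocity: extends the s-homomorphism [phi] to a g-homomorphism on the induced
    module. *)
Definition induced_lift_fun : induced L -> M :=
  tensor_lift (fun u m => env_act u (phi m)).

Let lift_linl (m : L) : linear (fun u : env_alg g => env_act u (phi m)).
Proof. exact: env_act_linearl. Qed.

Let lift_linr (u : env_alg g) : linear (fun m => env_act u (phi m)).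
Proof. by move=> c m m'; rewrite phi_lin env_act_linearr. Qed.

Let lift_bal (u : env_alg g) (a : env_alg s) (m : L) :
  env_act (u * env_incl a) (phi m) = env_act u (phi (env_act a m)).
Proof. by rewrite env_actM env_incl_act. Qed.

Lemma induced_lift_tens (u : env_alg g) (m : L) :
  induced_lift_fun (ind_tens u m) = env_act u (phi m).
Proof. exact: tensor_lift_tens. Qed.

Lemma induced_lift_linear : linear induced_lift_fun.
Proof. exact: tensor_lift_linear. Qed.

Lemma induced_lift_act (x : g) (t : induced L) :
  induced_lift_fun (lact x t) = lact x (induced_lift_fun t).
Proof.
move: t; apply: induced_ext => [c u v|c u v|u m].
- by rewrite lact_linearr induced_lift_linear.
- by rewrite induced_lift_linear lact_linearr.
- have e1 := induced_lift_tens u m; have e2 := induced_lift_tens (env_inj x * u) m.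
  by rewrite lact_ind_tens [LHS]e2 e1; apply: env_act_injM.
Qed.

Definition induced_lift : lieHom (induced L) M :=
  LieHom induced_lift_linear induced_lift_act.

Lemma induced_lift1 (m : L) : induced_lift (ind_tens 1 m) = phi m.
Proof. by rewrite [LHS]induced_lift_tens env_act1. Qed.

End InducedModules.

(** * A g-action on U(n) built from a complement of n *)

Lemma lie_leibniz (K : fieldType) (g : lieType K) (x y z : g) :
  [lie x, [lie y, z]] = [lie [lie x, y], z] + [lie y, [lie x, z]].
Proof.
have /eqP := lie_jacobi x y z; rewrite -addrA addr_eq0 => /eqP ->.
have -> : [lie y, [lie z, x]] = - [lie y, [lie x, z]].
  by rewrite (lieC z x) -scaleN1r lieZr scaleN1r.
by rewrite (lieC z) -opprD opprK addrC.
Qed.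

Section HomModule.
Variables (K : fieldType) (g : lieType K) (n : subalgebra g) (L : lieModule n).

Fact hom0 : linear (0 : g -> L).
Proof. by move=> c u v /=; rewrite scaler0 addr0. Qed.

Fact homP (c : K) (phi psi : g -> L) :
  linear phi -> linear psi -> linear (c *: phi + psi : g -> L).
Proof.
move=> lphi lpsi a u v.
rewrite [LHS]/(c *: phi (a *: u + v) + psi (a *: u + v)) lphi lpsi.
by rewrite comb_swap.
Qed.

Definition hom_space : subspace (g -> L) :=
  @Subspace K (g -> L) (fun phi => linear phi) hom0 homP.

Definition hom_type : lmodType K := subspace_type hom_space.

Definition hom_fun (phi : hom_type) : g -> L := val (phi : subspace_type hom_space).

Lemma hom_fun_linear (phi : hom_type) : linear (hom_fun phi).
Proof. exact: (@subspace_valP _ _ hom_space phi). Qed.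

Definition to_hom (f : g -> L) (lf : linear f) : hom_type :=
  @in_sub K (g -> L) hom_space f lf.

Lemma hom_eq (phi psi : hom_type) : (forall z, hom_fun phi z = hom_fun psi z) -> phi = psi.
Proof. by move=> e; apply: val_inj; apply/funext. Qed.

Lemma hom_addE (c : K) (phi psi : hom_type) (z : g) :
  hom_fun (c *: phi + psi) z = c *: hom_fun phi z + hom_fun psi z.
Proof. by []. Qed.

Lemma hom_subE (phi psi : hom_type) (z : g) :
  hom_fun (phi - psi) z = hom_fun phi z - hom_fun psi z.
Proof. by []. Qed.

(** The usual action on linear maps from g, under ad, to L: the order of the bracket absorbs the
    sign of -phi([x, z]). *)
Definition hom_act_fun (x : n) (phi : hom_type) (z : g) : L :=
  lact x (hom_fun phi z) + hom_fun phi [lie z, subalg_val x].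

Fact hom_act_subproof (x : n) (phi : hom_type) : linear (hom_act_fun x phi).
Proof.
move=> c u v; rewrite /hom_act_fun (lie_linearl (subalg_val x) c u v) !hom_fun_linear.
by rewrite lact_linearr scalerDr addrACA.
Qed.

Definition hom_act (x : n) (phi : hom_type) : hom_type :=
  to_hom (hom_act_subproof x phi).

Lemma hom_actE (x : n) (phi : hom_type) (z : g) :
  hom_fun (hom_act x phi) z = lact x (hom_fun phi z) + hom_fun phi [lie z, subalg_val x].
Proof. by []. Qed.

Fact hom_act_linearl (phi : hom_type) : linear (hom_act^~ phi).
Proof.
move=> c x y; apply: hom_eq => z; rewrite hom_addE !hom_actE.
by rewrite subalg_val_linear lie_linearr hom_fun_linear lact_linearl scalerDr addrACA.
Qed.

Fact hom_act_linearr (x : n) : linear (hom_act x).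
Proof.
move=> c phi psi; apply: hom_eq => z; rewrite hom_addE !hom_actE !hom_addE.
by rewrite lact_linearr scalerDr addrACA.
Qed.

Lemma hom_funB (phi : hom_type) (u v : g) :
  hom_fun phi (u - v) = hom_fun phi u - hom_fun phi v.
Proof.
have := hom_fun_linear phi (-1) v u.
by rewrite !scaleN1r ![- _ + _]addrC.
Qed.

Fact hom_act_lie (x y : n) (phi : hom_type) :
  hom_act [lie x, y] phi = hom_act x (hom_act y phi) - hom_act y (hom_act x phi).
Proof.
apply: hom_eq => z; rewrite hom_subE !hom_actE lact_lie !lactDr subalg_val_lie.
rewrite lie_leibniz (lieC (subalg_val x)) hom_funB.
set a := lact x (lact y _); set b := lact y (lact x _).
set p := lact x (hom_fun _ _); set q := lact y (hom_fun _ _).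
(* The mixed terms [p] and [q] occur in both iterated actions and cancel; regrouping brings them
   together. *)
have e (r t u w : L) : r + t + (u + w) = r + w + (t + u) by rewrite [u + w]addrC addrACA.
by rewrite (e a p) (e b q) [q + p]addrC [b + _ + _]addrC addrKA opprD addrACA.
Qed.

Definition hom_module : lieModule n :=
  @LieModule K n hom_type hom_act hom_act_linearl hom_act_linearr hom_act_lie.

End HomModule.

Lemma subr_interleave (V : zmodType) (p q r s t w : V) :
  p - q + (r - s + (t - w)) = p + t + r - (q + s + w).
Proof. by rewrite [p + t + r]addrAC !opprD [RHS]addrACA [p + r + _]addrACA -[RHS]addrA. Qed.

Section RegularModule.
Variables (K : fieldType) (n : lieType K).

Definition regular_act (x : n) (u : env_alg n) : env_alg n := env_inj x * u.

Fact regular_act_linearl (u : env_alg n) : linear (regular_act^~ u).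
Proof. by move=> c x y; rewrite /regular_act env_inj_linear mulrDl scalerAl. Qed.

Fact regular_act_linearr (x : n) : linear (regular_act x).
Proof. by move=> c u v; rewrite /regular_act mulrDr scalerAr. Qed.

Fact regular_act_lie (x y : n) (u : env_alg n) :
  regular_act [lie x, y] u = regular_act x (regular_act y u) - regular_act y (regular_act x u).
Proof. by rewrite /regular_act env_inj_lie mulrBl !mulrA. Qed.

Definition regular_module : lieModule n :=
  LieModule regular_act_linearl regular_act_linearr regular_act_lie.

End RegularModule.

Section Complement.
Variables (K : fieldType) (g : lieType K) (n b : subalgebra g).
Hypothesis complement :
  forall z : g, exists! p : n * b, z = subalg_val p.1 + subalg_val p.2.

Let parts (z : g) : {p : n * b | z = subalg_val p.1 + subalg_val p.2 &
  forall q : n * b, z = subalg_val q.1 + subalg_val q.2 -> p = q}.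
Proof. by have [p [pz pu]] := cid (complement z); exists p. Qed.

Definition npart (z : g) : n := let: exist2 p _ _ := parts z in p.1.
Definition bpart (z : g) : b := let: exist2 p _ _ := parts z in p.2.

Lemma parts_sum (z : g) : z = subalg_val (npart z) + subalg_val (bpart z).
Proof. by rewrite /npart /bpart; case: parts. Qed.

Lemma parts_uniq (z : g) (x : n) (y : b) :
  z = subalg_val x + subalg_val y -> npart z = x /\ bpart z = y.
Proof. by rewrite /npart /bpart; case: parts => p _ pu /(pu (x, y)) ->. Qed.

Lemma parts_linear (c : K) (z z' : g) :
  npart (c *: z + z') = c *: npart z + npart z' /\
  bpart (c *: z + z') = c *: bpart z + bpart z'.
Proof.
apply: parts_uniq; rewrite !subalg_val_linear {1}(parts_sum z) {1}(parts_sum z').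
by rewrite scalerDr addrACA.
Qed.

Variable chi : lieChar b.

(** The value forced on z 1 once n is to act by multiplication and b on 1 by [chi]. *)
Definition crossed_gen (z : g) : regular_module n :=
  env_inj (npart z) + (chi (bpart z) : K) *: (1 : env_alg n).

Fact crossed_gen_linear : linear crossed_gen.
Proof.
move=> c z z'; rewrite /crossed_gen; have [-> ->] := parts_linear c z z'.
rewrite env_inj_linear (linearP chi) scalerDl scalerDr -scalerA.
exact: (@addrACA (env_alg n)).
Qed.

Let gen : @hom_module _ g n (regular_module n) := to_hom crossed_gen_linear.

(** Read off from u applied to [gen] in Hom(g, U(n)), so that the commutation rule z (x u) = x (z u)
    + [z, x] u holds by construction. *)
Definition crossed_act (z : g) (u : env_alg n) : env_alg n := hom_fun (env_act u gen) z.

Lemma crossed_act1 (z : g) :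
  crossed_act z 1 = env_inj (npart z) + (chi (bpart z) : K) *: 1.
Proof. by rewrite /crossed_act env_act1. Qed.

Lemma crossed_actM (z : g) (x : n) (u : env_alg n) :
  crossed_act z (env_inj x * u) =
    env_inj x * crossed_act z u + crossed_act [lie z, subalg_val x] u.
Proof. by rewrite /crossed_act env_act_injM. Qed.

Fact crossed_act_linearl (u : env_alg n) : linear (crossed_act^~ u).
Proof. exact: (@hom_fun_linear _ _ _ (regular_module n) (env_act u gen)). Qed.

Fact crossed_act_linearr (z : g) : linear (crossed_act z).
Proof. by move=> c u v; rewrite /crossed_act env_act_linearl hom_addE. Qed.

Let actDl z z' u : crossed_act (z + z') u = crossed_act z u + crossed_act z' u.
Proof. by have := crossed_act_linearl u 1 z z'; rewrite !scale1r. Qed.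

Let actNl z u : crossed_act (- z) u = - crossed_act z u.
Proof.
by apply/eqP; rewrite -addr_eq0 -actDl addNr; have := crossed_act_linearl u (-1) 0 0;
  rewrite scaler0 addr0 scaleN1r addNr => ->.
Qed.

Let actDr z u v : crossed_act z (u + v) = crossed_act z u + crossed_act z v.
Proof. by have := crossed_act_linearr z 1 u v; rewrite !scale1r. Qed.

Let actZr z (c : K) u : crossed_act z (c *: u) = c *: crossed_act z u.
Proof. by apply: (@addIr _ (crossed_act z 0)); rewrite -crossed_act_linearr -actDr. Qed.

(** The commutation rule turns x (y u) into y x u + [x, y] u, which is x y u in U(n); this drives
    the induction on u. *)
Lemma crossed_act_npart (x : n) (u : env_alg n) :
  crossed_act (subalg_val x) u = env_inj x * u.
Proof.
move: u x; apply: (@env_alg_ind _ _ (fun u => forall x : n,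
    crossed_act (subalg_val x) u = env_inj x * u)) => [x|c u v IHu IHv x|y u IHu x].
- rewrite crossed_act1; have [-> ->] : npart (subalg_val x) = x /\ bpart (subalg_val x) = 0.
    by apply: parts_uniq; rewrite linear0 addr0.
  by rewrite linear0 scale0r addr0 mulr1.
- by rewrite crossed_act_linearr IHu IHv mulrDr scalerAr.
- rewrite crossed_actM IHu -subalg_val_lie IHu env_inj_lie mulrBl !mulrA.
  by rewrite addrC subrK.
Qed.

Lemma crossed_act_bpart1 (y : b) : crossed_act (subalg_val y) 1 = (chi y : K) *: 1.
Proof.
rewrite crossed_act1; have [-> ->] : npart (subalg_val y) = 0 /\ bpart (subalg_val y) = y.
  by apply: parts_uniq; rewrite linear0 add0r.
by rewrite linear0 add0r.
Qed.

(** Induction on u. At u = 1, linearity and antisymmetry reduce to pairs that meet n or lie in b;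
    from u to x u, the commutation rule produces iterated brackets that Jacobi matches. *)
Fact crossed_act_lie (z z' : g) (u : env_alg n) :
  crossed_act [lie z, z'] u =
    crossed_act z (crossed_act z' u) - crossed_act z' (crossed_act z u).
Proof.
move: u z z'; apply: (@env_alg_ind _ _ (fun u => forall z z', crossed_act [lie z, z'] u =
    crossed_act z (crossed_act z' u) - crossed_act z' (crossed_act z u)))
  => [z z'|c u v IHu IHv z z'|x u IHu z z'].
- pose P w w' := crossed_act [lie w, w'] 1 =
    crossed_act w (crossed_act w' 1) - crossed_act w' (crossed_act w 1).
  (* For y in n this is the commutation rule at u = 1. *)
  have Pn w (y : n) : P w (subalg_val y).
    by rewrite /P !crossed_act_npart crossed_actM addrC addKr.
  have PC w w' : P w w' -> P w' w.
    by rewrite /P => e; rewrite lieC actNl e opprB.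
  have PD w w1 w2 : P w w1 -> P w w2 -> P w (w1 + w2).
    by rewrite /P => e1 e2; rewrite lieDr !actDl actDr e1 e2 opprD addrACA.
  (* b acts on 1 by scalars and [chi] kills brackets, so both sides vanish. *)
  have Pb (y y' : b) : P (subalg_val y) (subalg_val y').
    rewrite /P -subalg_val_lie !crossed_act_bpart1 !actZr !crossed_act_bpart1.
    by rewrite char_lie scale0r !scalerA mulrC subrr.
  rewrite -/(P z z') (parts_sum z'); apply: (PD) (Pn _ _) _.
  by rewrite (parts_sum z); apply: (PC); apply: (PD) (Pn _ _) _; apply: (PC).
- by rewrite !crossed_act_linearr IHu IHv scalerBr opprD addrACA.
- rewrite !crossed_actM !actDr !crossed_actM IHu mulrBr.
  have -> : [lie [lie z, z'], subalg_val x] =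
      [lie z, [lie z', subalg_val x]] + [lie [lie z, subalg_val x], z'].
    by rewrite lie_leibniz (lieC z') addrNK.
  rewrite actDl (IHu z [lie z', subalg_val x]) (IHu [lie z, subalg_val x] z').
  exact: subr_interleave.
Qed.

Definition crossed_module : lieModule g :=
  LieModule crossed_act_linearl crossed_act_linearr crossed_act_lie.

End Complement.

(** * Existence of the Whittaker functional on N(-mu) *)

Section LowestVermaFunctional.
Variables (K : fieldType) (g : lieType K) (T : triangular g).
Local Notation np := (tri_np T).
Local Notation b := (borel T).

Lemma np_borel_complement (z : g) :
  exists! p : np * b, z = subalg_val p.1 + subalg_val p.2.
Proof.
have [[[y a] x] /= [zE _]] := tri_decomp T z.
have ya : in_borel T (subalg_val a + subalg_val y) by exists a, y.
pose v : b := @in_sub K g b _ ya.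
have vE : subalg_val v = subalg_val a + subalg_val y by [].
exists (x, v); split => [|[x' v'] /= zE'].
  by rewrite /= vE zE addrC [subalg_val y + _]addrC.
have [a' [y' vE']] := borel_hpart v'.
suff [ey ea ex] : (y, a, x) = (y', a', x').
  by rewrite ex; congr (_, _); apply: subalg_val_inj; rewrite vE vE' ey ea.
apply: tri_sum_uniq; rewrite /= -zE zE' vE'.
by rewrite addrC [subalg_val a' + _]addrC.
Qed.

Variables (lambda : lieChar np) (mu : dual (tri_h T)).
Local Notation chi := (neg_weight mu).
Local Notation N := (lowest_verma mu).
Local Notation V := (crossed_module np_borel_complement chi).

Definition verma_gen : N := @ind_tens K g b (char_module chi) 1 (1 : K^o).

Let one : V := (1 : env_alg np).

Let phi (c : char_module chi) : V := (c : K) *: one.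

Let phi_lin : linear phi.
Proof. by move=> c x y; rewrite /phi scalerDl scalerA. Qed.

Let phi_act x m : phi (lact x m) = lact (subalg_val x) (phi m).
Proof.
have e1 : lact (subalg_val x) (phi m) = (m : K) *: lact (subalg_val x) one.
  exact: lactZr.
have e2 : lact (subalg_val x) one = (chi x : K) *: one.
  exact: crossed_act_bpart1.
have e0 : lact x m = (m : K) * (chi x : K) by apply: etrans (mulrC _ _).
have e3 := congr1 phi e0.
apply: etrans (esym (etrans e1 (congr1 (fun v => (m : K) *: v) e2))).
rewrite e3; exact: esym (@scalerA K V (m : K) (chi x : K) one).
Qed.

Let F : lieHom N V := induced_lift phi_lin phi_act.

Let F1 : F verma_gen = one.
Proof. by rewrite [LHS]induced_lift1 /phi /= scale1r. Qed.

Let eps_lin : linear (fun x : np => - lambda x : K^o).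
Proof. by move=> c x y; rewrite linearP opprD scalerN. Qed.

Let eps_lie (x y : np) :
  - lambda [lie x, y] = (- lambda x : K^o) * (- lambda y) - (- lambda y : K^o) * (- lambda x).
Proof. by rewrite char_lie oppr0 !mulrNN mulrC subrr. Qed.

Let eps : env_alg np -> K^o := env_lift (fun x : np => - lambda x : K^o).

(** The functional is [eps] after [F]. The minus sign in [eps] cancels the one of the dual action,
    and [F] sends the generator to 1, where [eps] is 1. *)
Lemma whittaker_functional_exists :
  exists w : dual_module N, whittaker_vector lambda w /\ (w : dual N) verma_gen = 1.
Proof.
have epsF_lin : linear (eps \o F : N -> K^o).
  move=> c x y; apply: etrans (congr1 eps (lie_hom_linear F c x y)) _.
  exact: env_lift_linear eps_lin eps_lie c _ _.
exists (to_dual epsF_lin); split=> [x|].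
  apply: dual_eq => v; rewrite dual_actE.
  have -> : to_dual epsF_lin (- lact (subalg_val x) v) = - (eps (F (lact (subalg_val x) v))).
    by rewrite linearN.
  rewrite lie_hom_act [X in eps X]crossed_act_npart.
  by rewrite [eps _](env_liftM eps_lin eps_lie) (env_lift_inj eps_lin eps_lie) mulNr opprK.
rewrite [LHS]/(eps (F verma_gen)) F1; exact: env_lift1 eps_lin eps_lie.
Qed.

End LowestVermaFunctional.

(** * Uniqueness of the Whittaker functional *)

Lemma lact_span (K : fieldType) (g : lieType K) (M : lieModule g) (x : g)
    (S : set M) (W : subspace M) :
  (forall v, S v -> W (lact x v)) -> forall v, Defs.span S v -> W (lact x v).
Proof.
move=> SW.
have W0 : W (lact x 0) by rewrite lact0; apply: subspace0.
have WP (c : K) (u v : M) : W (lact x u) -> W (lact x v) -> W (lact x (c *: u + v)).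
  by move=> Wu Wv; rewrite lact_linearr; apply: subspaceP.
exact: (@span_min _ _ _ (@Subspace _ _ (fun v => W (lact x v)) W0 WP)).
Qed.

Lemma dual_subZE (K : fieldType) (g : lieType K) (M : lieModule g) (c : K)
    (f1 f2 : dual_module M) (v : M) :
  (f1 - c *: f2 : dual M) v = ((f1 : dual M) v : K) - c * ((f2 : dual M) v : K).
Proof. by []. Qed.

Section LowestVermaWhittaker.
Variables (K : fieldType) (g : lieType K) (T : triangular g).
Local Notation np := (tri_np T).
Variables (lambda : lieChar np) (mu : dual (tri_h T)).
Local Notation N := (lowest_verma mu).

Let word (s : seq np) : N :=
  foldr (fun x u => lact (subalg_val x) u) (verma_gen mu) s.

Let word_cons x s : word (x :: s) = lact (subalg_val x) (word s).
Proof. by []. Qed.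

Let words : set N := [set v | exists s, v = word s].

Let words_np (x : np) (v : N) : Defs.span words v -> Defs.span words (lact (subalg_val x) v).
Proof.
apply: lact_span => _ [s ->]; apply: Defs.sub_span.
by exists (x :: s).
Qed.

(** The span of the words in n is stable under g: z moves past a letter x at the cost of [z, x]
    acting on a shorter word, and at the generator z splits into an n-part and a b-part, the latter
    acting by a scalar. *)
Lemma lowest_verma_np (v : N) : Defs.span words v.
Proof.
move: v; apply: induced_gen => [z v|m]; last first.
  have -> : ind_tens 1 m = (m : K) *: verma_gen mu :> N.
    by rewrite /verma_gen -ind_tensZr; congr ind_tens; apply/esym/mulr1.
  by apply: subspaceZ; apply: Defs.sub_span; exists [::].
apply: lact_span => _ [s ->].
elim: s z => [|x s IHs] z; last first.
  by rewrite word_cons lact_comm; apply: subspaceD; [apply: IHs|apply: words_np].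
have [[x y] [zE _]] := np_borel_complement T z.
have {zE}-> : z = subalg_val x + subalg_val y := zE.
rewrite lactDl; apply: subspaceD; first by apply: Defs.sub_span; exists [:: x].
have -> : lact (subalg_val y) (verma_gen mu) = (neg_weight mu y : K) *: verma_gen mu.
  by apply: etrans (lact_ind_tens1 _ _) _; rewrite -ind_tensZr.
by apply: subspaceZ; apply: Defs.sub_span; exists [::].
Qed.

(** By w(x u) = -lambda(x) w(u), vanishing at the generator spreads to all words. *)
Lemma whittaker_functional_eq0 (w : dual_module N) :
  whittaker_vector lambda w -> (w : dual N) (verma_gen mu) = 0 -> w = 0.
Proof.
move=> ww w0; apply: dual_eq => v.
have -> : (0 : dual N) v = 0 by [].
have Z0 : (w : dual N) 0 = 0 by rewrite linear0.
have ZP (c : K) (u u' : N) : (w : dual N) u = 0 -> (w : dual N) u' = 0 ->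
    (w : dual N) (c *: u + u') = 0.
  by move=> wu wu'; rewrite (dual_fun_linear w c u) wu wu' scaler0 addr0.
apply: (@span_min _ _ words (@Subspace _ _ (fun v => (w : dual N) v = 0) Z0 ZP));
  last exact: lowest_verma_np.
move=> _ [s ->]; elim: s => // x s; rewrite word_cons; move: (word s) => u wu.
have e : (w : dual N) (- lact (subalg_val x) u) = (lambda x : K) *: (w : dual N) u.
  by rewrite -dual_actE [dual_act _ _](ww x).
have {}wu : (w : dual N) u = 0 := wu.
rewrite wu scaler0 linearN in e; move: e => /eqP.
by rewrite oppr_eq0 => /eqP.
Qed.

Lemma whittaker_functional_line (u w : dual_module N) :
  whittaker_vector lambda u -> whittaker_vector lambda w ->
  (w : dual N) (verma_gen mu) <> 0 -> exists c : K, u = c *: w.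
Proof.
move=> uW wW /eqP w0.
(* With this ratio, u - c w vanishes at the generator. *)
exists (((u : dual N) (verma_gen mu) : K) / ((w : dual N) (verma_gen mu) : K)).
set c : K := _ / _; apply/eqP; rewrite -subr_eq0; apply/eqP.
apply: whittaker_functional_eq0 => [x|].
  by rewrite lactBr lactZr uW wW scalerBr !scalerA mulrC.
apply: etrans (@dual_subZE K g N c u w (verma_gen mu)) _.
by apply/eqP; rewrite subr_eq0; apply/eqP/esym/divfK.
Qed.

End LowestVermaWhittaker.

(** * Heights of weights and local nilpotence of ad n on g / n *)

Section LinIndepSums.
Variables (K : fieldType) (V : lmodType K).
Hypothesis K0 : forall n, n.+1%:R != 0 :> K.

Lemma sum_count_mem (u s : seq V) : uniq u -> {subset s <= u} ->
  \sum_(b <- s) b = \sum_(b <- u) (count_mem b s)%:R *: b.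
Proof.
move=> Uu; elim: s => [|x s IHs] su.
  by rewrite big_nil big1 // => b _; rewrite scale0r.
have xu : x \in u by apply: su; rewrite mem_head.
rewrite big_cons IHs; last by move=> b bs; apply: su; rewrite inE bs orbT.
under [RHS]eq_bigr => b _ do rewrite /= natrD scalerDl.
rewrite big_split /=; congr (_ + _).
rewrite (bigD1_seq x) //= eqxx scale1r big1 ?addr0 // => b.
by rewrite eq_sym => /negbTE ->; rewrite scale0r.
Qed.

(** The differences of multiplicities are the coefficients of a vanishing combination;
    characteristic zero makes the multiplicities themselves agree. Hence the number of terms, the
    height, is well defined. *)
Lemma lin_indep_perm (B : set V) (s t : seq V) : lin_indep B ->
  {in s, forall b, B b} -> {in t, forall b, B b} ->
  \sum_(b <- s) b = \sum_(b <- t) b -> perm_eq s t.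
Proof.
move=> Bfree sB tB st; pose u := undup (s ++ t).
have Uu : uniq u := undup_uniq _.
have su : {subset s <= u} by move=> b bs; rewrite mem_undup mem_cat bs.
have tu : {subset t <= u} by move=> b bt; rewrite mem_undup mem_cat bt orbT.
pose c (b : V) : K := (count_mem b s)%:R - (count_mem b t)%:R.
have uB : {in u, forall b, B b}.
  by move=> b; rewrite mem_undup mem_cat => /orP[/sB|/tB].
have c0 : {in u, forall b, c b = 0}.
  apply: Bfree => //.
  under eq_bigr => b _ do rewrite /c scalerBl.
  by rewrite sumrB -!sum_count_mem // st subrr.
have natr_le (p q : nat) : p%:R = q%:R :> K -> (p <= q)%N.
  rewrite leqNgt => e; apply/negP => qp; have := K0 (p - q).-1.
  by rewrite prednK ?subn_gt0 // natrB 1?ltnW // e subrr eqxx.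
apply/allP => b; rewrite -mem_undup => /c0/eqP; rewrite subr_eq0 => /eqP e.
by rewrite /= eqn_leq !natr_le.
Qed.

End LinIndepSums.

Section Depth.
Variables (K : fieldType) (g : lieType K) (n : subalgebra g).

(* The image of z in g / n is killed by all d-fold products of elements of n. *)
Fixpoint depth (d : nat) (z : g) : Prop :=
  if d is d'.+1 then forall x : n, depth d' [lie subalg_val x, z] else n z.

End Depth.

Section TriangularDepth.
Variables (K : fieldType) (g : lieType K) (T : triangular g).
Hypothesis K0 : forall n, n.+1%:R != 0 :> K.
Local Notation nm := (tri_nm T).
Local Notation h := (tri_h T).
Local Notation np := (tri_np T).

Let wt (gamma : dual h) (z : g) : Prop :=
  forall a : h, [lie subalg_val a, z] = (gamma a : K) *: z.

(** Weights of g are differences of sums over B, with height the difference of the numbers of terms.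
    Brackets with weight vectors of n raise it, and positive height forces membership in n. *)
Lemma tri_np_finite_depth (z : g) : exists d, depth np d z.
Proof.
have [sigma [sigma_lie sigmaK sigma_np sigma_h]] := tri_anti_involution T.
have [B Bfree Bpos] := tri_weights_pos T.
(* [sigma] reverses brackets and fixes h, hence negates weights; this gives the sign of the weights
   of n_-. *)
have wt_sigma gamma w : wt gamma w -> wt (- gamma) (sigma w).
  move=> ww a; rewrite -{1}(sigma_h _ (subalg_valP a)) -sigma_lie lieC ww.
  by rewrite linearN linearZ -scaleNr.
have sigma_nm y : nm y -> np (sigma y).
  move=> nmy; have [x npx <-] : (sigma @` np) y by rewrite sigma_np.
  by rewrite sigmaK.
(* The bound says that the height |s| - |t| exceeds -d. *)
pose E d := [set w : g | exists gamma : dual h, exists s, exists t, [/\ wt gamma w,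
  {in s, forall b, B b}, {in t, forall b, B b},
  gamma + \sum_(b <- t) b = \sum_(b <- s) b & (size t < size s + d)%N]].
have szE s t : {in s, forall b, B b} -> {in t, forall b, B b} ->
    \sum_(b <- s) b = \sum_(b <- t) b -> size s = size t.
  by move=> sB tB st; apply/perm_size/(lin_indep_perm K0 Bfree).
(* Here the height is positive. Each component of w has weight gamma: a nonzero n_- component would
   make the height at most 0, and a nonzero h component would make gamma zero. *)
have E0 w : E 0%N w -> np w.
  move=> [gamma [s [t [ww sB tB gst]]]]; rewrite addn0 => ts.
  have [[[y a] x] [zE _]] := tri_decomp T w.
  have {}zE : w = subalg_val y + subalg_val a + subalg_val x := zE.
  have comp (e : h) : [/\ [lie subalg_val e, subalg_val y] = (gamma e : K) *: subalg_val y,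
      (gamma e : K) *: a = 0
      & [lie subalg_val e, subalg_val x] = (gamma e : K) *: subalg_val x].
    have ey := tri_nm_stable (subalg_valP e) (subalg_valP y).
    have ex := tri_np_stable (subalg_valP e) (subalg_valP x).
    pose y' : nm := @in_sub K g nm _ ey; pose x' : np := @in_sub K g np _ ex.
    have ae : [lie subalg_val e, subalg_val a] = 0.
      by rewrite -subalg_val_lie tri_h_abelian linear0.
    have eq3 : (y', 0, x') =
        ((gamma e : K) *: y, (gamma e : K) *: a, (gamma e : K) *: x).
      apply: tri_sum_uniq; rewrite /= !linearZ -!scalerDr -zE -ww zE !lieDr ae.
      by rewrite linear0.
    have yE : y' = (gamma e : K) *: y := congr1 (fun p => p.1.1) eq3.
    have xE : x' = (gamma e : K) *: x := congr1 (fun p => p.2) eq3.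
    split; first exact: etrans (congr1 (@subalg_val _ _ _) yE) (linearZ _ _).
      exact: esym (congr1 (fun p => p.1.2) eq3).
    exact: etrans (congr1 (@subalg_val _ _ _) xE) (linearZ _ _).
  have y0 : subalg_val y = 0.
    apply: contrapT => y0.
    have wy : weight_space np (- gamma) (sigma (subalg_val y)).
      split; first exact/sigma_nm/subalg_valP.
      by apply: wt_sigma => e; have [] := comp e.
    have sy0 : sigma (subalg_val y) <> 0.
      by move=> sy; apply: y0; rewrite -[subalg_val y]sigmaK sy linear0.
    have [[r rB gr] _] := Bpos _ _ wy sy0.
    have /szE : \sum_(b <- t) b = \sum_(b <- r ++ s) b.
      by rewrite big_cat /= -gr -gst addrA addNr add0r.
    move=> /(_ tB); rewrite size_cat => e.
    by move: ts; rewrite e ?ltnNge ?leq_addl // => b; rewrite mem_cat => /orP[/rB|/sB].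
  have a0 : subalg_val a = 0.
    apply: contrapT => a0.
    have g0 : gamma = 0.
      apply: val_inj; apply/funext => e; have [_ /eqP + _] := comp e.
      rewrite scaler_eq0 => /orP[/eqP //|/eqP a0'].
      by case: a0; rewrite a0' linear0.
    by move: ts; rewrite g0 add0r in gst; rewrite (szE _ _ tB sB gst) ltnn.
  by rewrite zE y0 a0 !add0r; apply: subalg_valP.
(* A nonzero weight vector of n has weight alpha <> 0, so r is nonempty, and appending it to s
   raises the height by at least one. *)
have E1 d x w : np x -> Defs.span (E d.+1) w -> Defs.span (E d) [lie x, w].
  move=> /tri_np_weights xW; move: x xW w.
  have W0 w : Defs.span (E d.+1) w -> Defs.span (E d) [lie 0, w].
    by move=> _; rewrite lie0x; apply: subspace0.
  have WP c x x' :
      (forall w, Defs.span (E d.+1) w -> Defs.span (E d) [lie x, w]) ->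
      (forall w, Defs.span (E d.+1) w -> Defs.span (E d) [lie x', w]) ->
      forall w, Defs.span (E d.+1) w -> Defs.span (E d) [lie c *: x + x', w].
    by move=> hx hx' w Ew; rewrite lieDl lieZl; apply: subspaceP; [apply: hx|apply: hx'].
  apply: (@span_min _ _ _ (@Subspace _ _ (fun x => forall w, Defs.span (E d.+1) w ->
    Defs.span (E d) [lie x, w]) W0 WP)) => x [alpha _ [npx wx]] /=.
  have V0 : Defs.span (E d) [lie x, 0] by rewrite liex0; apply: subspace0.
  have VP c w w' : Defs.span (E d) [lie x, w] -> Defs.span (E d) [lie x, w'] ->
      Defs.span (E d) [lie x, c *: w + w'].
    by move=> hw hw'; rewrite lieDr lieZr; apply: subspaceP.
  apply: (@span_min _ _ _ (@Subspace _ _ (fun w => Defs.span (E d) [lie x, w]) V0 VP)).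
  move=> w [gamma [s [t [ww sB tB gst ts]]]] /=.
  have [->|/eqP x0] := eqVneq x 0; first by rewrite lie0x; apply: span_set0.
  have [[r rB ar] alpha0] := Bpos _ _ (conj npx wx) x0.
  apply: Defs.sub_span; exists (alpha + gamma), (r ++ s), t; split=> //.
  - by move=> a; rewrite lie_leibniz wx ww lieZl lieZr -scalerDl.
  - by move=> b; rewrite mem_cat => /orP[/rB|/sB].
  - by rewrite big_cat /= -ar -gst addrA.
  - rewrite size_cat; case: r ar {rB} => [|b r] /= ar.
      by case: alpha0; rewrite ar big_nil.
    rewrite addnS ltnS in ts; rewrite !addSn ltnS.
    by apply: leq_trans ts _; rewrite leq_add2r leq_addl.
have EW d e w : (d <= e)%N -> Defs.span (E d) w -> Defs.span (E e) w.
  move=> de; apply: span_min => v [gamma [s [t [ww sB tB gst ts]]]].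
  apply: Defs.sub_span; exists gamma, s, t; split=> //.
  by apply: leq_trans ts _; rewrite leq_add2l.
(* The n_- part is reached through [sigma]; the h part has height 0, hence lies in [E 1], and the
   n_+ part lies in the span of [E 0]. *)
have Ez w : exists d, Defs.span (E d) w.
  have ED u v : (exists d, Defs.span (E d) u) -> (exists d, Defs.span (E d) v) ->
      exists d, Defs.span (E d) (u + v).
    move=> [d du] [e ev]; exists (maxn d e); apply: subspaceD.
      by apply: EW du; apply: leq_maxl.
    by apply: EW ev; apply: leq_maxr.
  have [[[y a] x] [-> _]] := tri_decomp T w; rewrite /=.
  apply: (ED); first apply: (ED).
  - have <- := sigmaK (subalg_val y).
    have := tri_np_weights (sigma_nm _ (subalg_valP y)); move: (sigma _).
    have W0 : exists d, Defs.span (E d) (sigma 0).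
      by exists 0%N; rewrite linear0; apply: subspace0.
    have WP c u v : (exists d, Defs.span (E d) (sigma u)) ->
        (exists d, Defs.span (E d) (sigma v)) ->
        exists d, Defs.span (E d) (sigma (c *: u + v)).
      move=> [d du] ev; rewrite linearP; apply: (ED) ev.
      by exists d; apply: subspaceZ.
    apply: (@span_min _ _ _ (@Subspace _ _ (fun u => exists d, Defs.span (E d) (sigma u)) W0 WP)).
    move=> u [alpha _ [npu wu]] /=.
    have [->|/eqP u0] := eqVneq u 0; first exact: W0.
    have [[r rB ar] _] := Bpos _ _ (conj npu wu) u0.
    (* The height is minus the length of r, so the strict bound needs one more. *)
    exists (size r).+1; apply: Defs.sub_span; exists (- alpha), [::], r; split=> //.
      exact: wt_sigma.
    by rewrite big_nil ar addNr.
  - exists 1%N; apply: Defs.sub_span; exists 0, [::], [::]; split=> //.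
      by move=> e; rewrite -subalg_val_lie tri_h_abelian linear0 scale0r.
    by rewrite add0r.
  - exists 0%N; have := tri_np_weights (subalg_valP x); move: (subalg_val x).
    apply: span_min => u [alpha _ [npu wu]].
    have [->|/eqP u0] := eqVneq u 0; first exact: span_set0.
    have [[r rB ar] alpha0] := Bpos _ _ (conj npu wu) u0.
    apply: Defs.sub_span; exists alpha, r, [::]; split=> //.
      by rewrite big_nil addr0.
    by case: r ar {rB} => // ar; case: alpha0; rewrite ar big_nil.
have [d dz] := Ez z; exists d; elim: d z dz => [|d IHd] z dz.
  exact: (@span_min _ _ (E 0%N) np) dz.
by move=> x; apply: IHd; apply: E1 dz; apply: subalg_valP.
Qed.

End TriangularDepth.

(** * The filtration by words applied to a Whittaker vector *)

Lemma unzip1_cat (A B : Type) (ps : seq (A * B)) (s1 s2 : seq A) (z : A) :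
  unzip1 ps = s1 ++ z :: s2 -> exists ps1 (e : B) ps2,
    [/\ ps = ps1 ++ (z, e) :: ps2, s1 = unzip1 ps1 & s2 = unzip1 ps2].
Proof.
elim: s1 ps => [|y s1 IHs] [|[y' e] ps] //= [-> psE].
  by exists [::], e, ps.
by have [ps1 [e' [ps2 [-> -> ->]]]] := IHs _ psE; exists ((y, e) :: ps1), e', ps2.
Qed.

Section WhittakerFiltration.
Variables (K : fieldType) (g : lieType K) (n : subalgebra g) (lambda : lieChar n).
Hypothesis n_depth : forall z : g, exists d, depth n d z.
Variables (M : lieModule g) (w : M).
Hypothesis whit_w : whittaker_vector lambda w.

Local Notation lam x := (lambda x : K).

Let word (s : seq g) : M := foldr (fun z v => lact z v) w s.

Let word_cat s t : word (s ++ t) = foldr (fun z v => lact z v) (word t) s.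
Proof. exact: foldr_cat. Qed.

(* This is U(g)_{<k} w, with index 0 giving the zero subspace. *)
Definition filtration (k : nat) : subspace M :=
  Defs.span [set v | exists2 s, (size s < k)%N & v = word s].

Lemma filtration_word k s : (size s < k)%N -> filtration k (word s).
Proof. by move=> sk; apply: Defs.sub_span; exists s. Qed.

Lemma filtrationS k l v : (k <= l)%N -> filtration k v -> filtration l v.
Proof.
move=> kl; apply: span_min => _ [s sk ->].
by apply: filtration_word; apply: leq_trans sk kl.
Qed.

Definition shift (x : n) (v : M) : M := lact (subalg_val x) v - lam x *: v.

Lemma shiftP x c u v : shift x (c *: u + v) = c *: shift x u + shift x v.
Proof.
rewrite /shift lact_linearr scalerDr opprD addrACA scalerBr !scalerA.
by rewrite mulrC.
Qed.

(* x - lambda x acts on words as the derivation ad x because it kills w. *)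
Lemma shift_word (W : subspace M) (p s : seq g) (x : n) :
  (forall s1 z s2, s = s1 ++ z :: s2 ->
    W (word (p ++ s1 ++ [lie subalg_val x, z] :: s2))) ->
  W (foldr (fun z v => lact z v) (shift x (word s)) p).
Proof.
have fold0 q : foldr (fun z v => lact z v) (0 : M) q = 0.
  by elim: q => //= z q ->; rewrite lact0.
have foldD q u v : foldr (fun z v => lact z v) (u + v : M) q =
    foldr (fun z v => lact z v) u q + foldr (fun z v => lact z v) v q.
  by elim: q => //= z q ->; rewrite lactDr.
elim: s p => [|z s IHs] p Ws.
  have -> : shift x (word [::]) = 0 by rewrite /shift [word _]/= whit_w subrr.
  by rewrite fold0; apply: subspace0.
have -> : shift x (word (z :: s)) = lact [lie subalg_val x, z] (word s) + lact z (shift x (word s)).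
  by rewrite /shift [word (z :: s)]/= lact_comm lactBr lactZr addrA.
rewrite foldD; apply: subspaceD.
  by have := Ws [::] z s erefl; rewrite /= word_cat.
have := IHs (rcons p z); rewrite foldr_rcons; apply=> s1 y s2 sE.
by have := Ws (z :: s1) y s2; rewrite sE cat_rcons; apply.
Qed.

(** The derivation ad x replaces one letter at a time, so lengths do not grow. *)
Lemma shift_filtration k x v : filtration k v -> filtration k (shift x v).
Proof.
move: v; have F0 : filtration k (shift x 0).
  by rewrite /shift lact0 scaler0 subrr; apply: subspace0.
have FP c u v : filtration k (shift x u) -> filtration k (shift x v) ->
    filtration k (shift x (c *: u + v)).
  by move=> Fu Fv; rewrite shiftP; apply: subspaceP.
apply: (@span_min _ _ _ (@Subspace _ _ (fun v => filtration k (shift x v)) F0 FP)).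
move=> _ [s sk ->]; apply: (@shift_word _ [::]) => s1 z s2 sE.
by apply: filtration_word; move: sk; rewrite sE /= !size_cat.
Qed.

(** Write x as lambda x plus the shift. On the word s the shift is a derivation, so both terms lie
    in the span of words with one letter fewer. *)
Lemma filtration_n_letter (p s : seq g) (x : n) :
  filtration (size (p ++ subalg_val x :: s)) (word (p ++ subalg_val x :: s)).
Proof.
set k := size _.
have kE : k = (size p + size s).+1 by rewrite /k size_cat addnS.
have -> : word (p ++ subalg_val x :: s) =
    foldr (fun z v => lact z v) (shift x (word s)) p + lam x *: word (p ++ s).
  have fold_split (u v : M) q : foldr (fun z v => lact z v) u q =
      foldr (fun z v => lact z v) (u - lam x *: v) q +
      lam x *: foldr (fun z v => lact z v) v q.
    by elim: q => [|z q IHq] /=; rewrite ?subrK // IHq lactDr lactZr.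
  by rewrite !word_cat; apply: fold_split.
apply: subspaceD.
  apply: shift_word => s1 z s2 sE; apply: filtration_word.
  by rewrite kE sE !size_cat.
by apply: subspaceZ; apply: filtration_word; rewrite kE size_cat.
Qed.

Fixpoint nilp (W : subspace M) (d : nat) (v : M) : Prop :=
  if d is d'.+1 then forall x : n, nilp W d' (shift x v) else W v.

Lemma nilpP W d c u v : nilp W d u -> nilp W d v -> nilp W d (c *: u + v).
Proof.
elim: d u v => [|d IHd] u v /= du dv; first exact: subspaceP.
by move=> x; rewrite shiftP; apply: IHd.
Qed.

(** Rests on the stability of [filtration k] under shifts. *)
Lemma nilpW k d e v : (d <= e)%N -> nilp (filtration k) d v -> nilp (filtration k) e v.
Proof.
elim: d e v => [|d IHd] [|e] v //= de dv x; last by apply: IHd de _; apply: dv.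
have {dv} : filtration k (shift x v) by apply: shift_filtration.
move: (shift x v) => {}v; elim: e {de} v => //= e IHe v Fv y.
by apply: IHe; apply: shift_filtration.
Qed.

(** Each letter carries a bound on its depth. A shift brackets one letter with x and lowers its
    bound by one, so the sum of the bounds controls how many shifts remain before a letter of n is
    hit. *)
Lemma word_nilp (s : seq g) : exists d, nilp (filtration (size s)) d (word s).
Proof.
set F := filtration _.
have nilp0 d : nilp F d 0 by apply: (nilpW (leq0n d)); apply: subspace0.
have H d (ps : seq (g * nat)) : size ps = size s ->
    {in ps, forall p, depth n p.2 p.1} -> (sumn (unzip2 ps) < d)%N ->
    nilp F d (word (unzip1 ps)).
  elim: d ps => // d IHd ps szs dps ltd x.
  pose W := Subspace (nilp0 d) (@nilpP F d).
  apply: (@shift_word W [::]) => s1 z s2 ps12.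
  have [ps1 [e [ps2 [psE -> ->]]]] := unzip1_cat ps12.
  have := dps (z, e); rewrite psE mem_cat mem_head orbT => /(_ isT) /=.
  (* Bound 0 means that z is in n, so [x, z] is in n and the word reduces to shorter ones. *)
  case: e psE => [|e] psE ez.
    have xz : n [lie subalg_val x, z] by apply: subalg_lie => //; apply: subalg_valP.
    apply: (nilpW (leq0n d)); rewrite /= /F -szs psE.
    have := @filtration_n_letter (unzip1 ps1) (unzip1 ps2) (@in_sub K g n _ xz).
    by rewrite !size_cat /= !size_map.
  have -> : unzip1 ps1 ++ [lie subalg_val x, z] :: unzip1 ps2 =
      unzip1 (ps1 ++ ([lie subalg_val x, z], e) :: ps2) by rewrite /unzip1 map_cat.
  apply: IHd => [|p|].
  - by rewrite -szs psE !size_cat.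
  - rewrite mem_cat inE => /or3P[p1|/eqP->|p2].
    + by apply: dps; rewrite psE mem_cat p1.
    + exact: ez.
    + by apply: dps; rewrite psE mem_cat inE p2 !orbT.
  - by move: ltd; rewrite psE /unzip2 !map_cat !sumn_cat /= addSn addnS ltnS.
have [ds dsP] := choice n_depth.
have -> : word s = word (unzip1 [seq (z, ds z) | z <- s]).
  by rewrite /unzip1 -map_comp map_id.
(* The extra shift covers the case where the sum of the bounds is 0. *)
exists (sumn (unzip2 [seq (z, ds z) | z <- s])).+1; apply: H => //.
  by rewrite size_map.
by move=> _ /mapP[z _ ->]; apply: dsP.
Qed.

Lemma filtration_nilp k v : filtration k.+1 v -> exists d, nilp (filtration k) d v.
Proof.
move: v; have N0 : exists d, nilp (filtration k) d 0 by exists 0%N; apply: subspace0.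
have NP c u v : (exists d, nilp (filtration k) d u) -> (exists d, nilp (filtration k) d v) ->
    exists d, nilp (filtration k) d (c *: u + v).
  move=> [d du] [e ev]; exists (maxn d e); apply: nilpP.
    by apply: nilpW du; apply: leq_maxl.
  by apply: nilpW ev; apply: leq_maxr.
apply: (@span_min _ _ _ (@Subspace _ _ (fun v => exists d, nilp (filtration k) d v) N0 NP)).
move=> _ [s sk ->] /=; have [<-|sk'] := eqVneq (size s) k; first exact: word_nilp.
by exists 0%N; apply: filtration_word; rewrite ltn_neqAle sk' -ltnS.
Qed.

(** Induction on k, then on d. A nonzero shift of v replaces v, staying in S and lowering d; if all
    shifts vanish, v is the required vector. At d = 0, v lies in the next lower filtration step. *)
Lemma whittaker_in_submodule (S : subspace M) (k : nat) (v : M) :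
  stable S -> S v -> v <> 0 -> filtration k v ->
  exists u, [/\ S u, u <> 0 & whittaker_vector lambda u].
Proof.
move=> Sst; elim: k v => [|k IHk] v Sv v0 Fv.
  (* [filtration 0] is spanned by the empty set, so v would be 0. *)
  have ZP (c : K) (u u' : M) : u = 0 -> u' = 0 -> c *: u + u' = 0.
    by move=> -> ->; rewrite scaler0 addr0.
  have Z u : [set v | exists2 s, (size s < 0)%N & v = word s] u -> u = 0 by case.
  by case: (v0 (@span_min _ _ _ (@Subspace _ _ (fun u : M => u = 0) erefl ZP) Z v Fv)).
have Sshift x u : S u -> S (shift x u).
  by move=> Su; apply: subspaceB; [apply: Sst|apply: subspaceZ].
have [d dv] := filtration_nilp Fv.
elim: d v Sv v0 dv {Fv} => [|d IHd] v Sv v0 /= dv; first exact: IHk Sv v0 dv.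
have [vW|/existsNP[x vx]] := pselect (forall x, shift x v = 0).
  exists v; split=> // x; apply/eqP; rewrite -subr_eq0; apply/eqP; exact: vW.
by apply: IHd vx _; [apply: Sshift|apply: dv].
Qed.

End WhittakerFiltration.

(** * Quotients of the standard Whittaker module *)

Section StandardWhittaker.
Variables (K : fieldType) (g : lieType K) (n : subalgebra g) (lambda : lieChar n).
Local Notation L := (standard_whittaker lambda).

Definition whittaker_gen : L := @ind_tens K g n (char_module lambda) 1 (1 : K^o).

Lemma whittaker_gen_tens (c : char_module lambda) :
  ind_tens 1 c = (c : K) *: whittaker_gen :> L.
Proof.
by rewrite /whittaker_gen -ind_tensZr; congr ind_tens; apply/esym/mulr1.
Qed.

Lemma whittaker_genP : whittaker_vector lambda whittaker_gen.
Proof. by move=> x; apply: etrans (lact_ind_tens1 _ _) _; apply: ind_tensZr. Qed.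

Lemma whittaker_gen_stable (W : subspace L) :
  stable W -> W whittaker_gen -> forall m, W m.
Proof.
move=> Wst Wgen; apply: induced_gen; first exact: Wst.
by move=> c; rewrite whittaker_gen_tens; apply: subspaceZ.
Qed.

(** M_lambda is universal for Whittaker vectors: c |-> c w is a map of n-modules and lifts. *)
Lemma whittaker_lift (M : lieModule g) (w : M) : whittaker_vector lambda w ->
  exists F : lieHom L M, F whittaker_gen = w.
Proof.
move=> ww; pose phi (c : char_module lambda) : M := (c : K) *: w.
have phi_lin : linear phi by move=> c x y; rewrite /phi scalerDl scalerA.
have phi_act x m : phi (lact x m) = lact (subalg_val x) (phi m).
  have e0 : lact x m = (m : K) * (lambda x : K) by apply: etrans (mulrC _ _).
  rewrite (congr1 phi e0) /phi lactZr ww.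
  exact: esym (@scalerA K M (m : K) (lambda x : K) w).
exists (induced_lift phi_lin phi_act).
by rewrite [LHS]induced_lift1 /phi scale1r.
Qed.

Hypothesis n_depth : forall z : g, exists d, depth n d z.
Variables (M : lieModule g) (F : lieHom L M).
Hypothesis F_surj : forall v, exists m, v = F m.
Hypothesis M_neq0 : exists v : M, v <> 0.
Local Notation w := (F whittaker_gen).
Hypothesis line : forall u, whittaker_vector lambda u -> exists c : K, u = c *: w.

Let F0 : F 0 = 0.
Proof.
by have := lie_hom_linear F (-1) 0 0; rewrite scaler0 addr0 scaleN1r addNr.
Qed.

Let FZ (c : K) v : F (c *: v) = c *: F v.
Proof. by have := lie_hom_linear F c v 0; rewrite F0 !addr0. Qed.

(** The preimage of W under [F] is stable and contains the canonical generator. *)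
Lemma whittaker_image_gen (W : subspace M) : stable W -> W w -> forall v, W v.
Proof.
move=> Wst Ww v; have [m ->] := F_surj v.
have W0 : W (F 0) by rewrite F0; apply: subspace0.
have WP (c : K) x y : W (F x) -> W (F y) -> W (F (c *: x + y)).
  by move=> Wx Wy; rewrite lie_hom_linear; apply: subspaceP.
move: m; apply: (@whittaker_gen_stable (@Subspace _ _ (fun m => W (F m)) W0 WP)) => //.
by move=> z m Wm /=; rewrite lie_hom_act; apply: Wst.
Qed.

Lemma whittaker_image_genP : whittaker_vector lambda w.
Proof. by move=> x; rewrite -lie_hom_act whittaker_genP FZ. Qed.

Lemma whittaker_image_gen_neq0 : w <> 0.
Proof.
move=> w0; have [v []] := M_neq0.
have Z0 : (0 : M) = 0 by [].
have ZP (c : K) (u u' : M) : u = 0 -> u' = 0 -> c *: u + u' = 0.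
  by move=> -> ->; rewrite scaler0 addr0.
(* The zero subspace is stable and would contain w, hence be all of M. *)
apply: (@whittaker_image_gen (@Subspace _ _ (fun u : M => u = 0) Z0 ZP)) => //.
by move=> z u /= ->; rewrite lact0.
Qed.

Lemma filtration_exhaustive (v : M) : exists k, filtration w k v.
Proof.
have G0 : exists k, filtration w k 0 by exists 0%N; apply: subspace0.
have GP (c : K) u u' : (exists k, filtration w k u) -> (exists k, filtration w k u') ->
    exists k, filtration w k (c *: u + u').
  move=> [k ku] [l lu']; exists (maxn k l); apply: subspaceP.
    by apply: filtrationS ku; apply: leq_maxl.
  by apply: filtrationS lu'; apply: leq_maxr.
move: v; apply: (@whittaker_image_gen (@Subspace _ _ (fun v => exists k, filtration w k v) G0 GP)).
  move=> z v [k kv]; exists k.+1; move: kv; apply: lact_span => _ [s sk ->].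
  exact: (@filtration_word _ _ _ _ _ (z :: s)).
by exists 1%N; apply: (@filtration_word _ _ _ _ _ [::]).
Qed.

(** A nonzero submodule contains some c w with c <> 0, hence w, hence everything. Dimension at most
    one is [line]; at least one is w <> 0. *)
Lemma whittaker_quotient_simple :
  simple_module M /\ has_dim (whittaker_vector lambda (M := M)) 1.
Proof.
split; [split=> // W Wst|].
  have [[v [Wv v0]]|Wz] := pselect (exists v, W v /\ v <> 0); last first.
    by left=> v Wv; apply: contrapT => v0; apply: Wz; exists v.
  right; have [k kv] := filtration_exhaustive v.
  have [u [Wu u0 /line[c uE]]] :=
    whittaker_in_submodule n_depth whittaker_image_genP Wst Wv v0 kv.
  have c0 : c != 0 by apply/eqP => c0; apply: u0; rewrite uE c0 scale0r.
  apply: whittaker_image_gen => //.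
  by rewrite -[w](scalerK c0) -uE; apply: subspaceZ.
exists (fun=> w); split=> [v|c].
  split=> [/line[c ->]|[c ->]].
    by exists (fun=> c); rewrite big_ord1.
  by move=> x; rewrite big_ord1 lactZr whittaker_image_genP !scalerA mulrC.
rewrite big_ord1 => /eqP; rewrite scaler_eq0 => /orP[/eqP c0 i|/eqP w0].
  by rewrite ord1.
by case: whittaker_image_gen_neq0.
Qed.

End StandardWhittaker.

(** * Application to the image L(lambda, mu) *)

Lemma whittaker_vector_val (K : fieldType) (g : lieType K) (n : subalgebra g)
    (lambda : lieChar n) (M : lieModule g) (W : subspace M) (Wst : stable W)
    (v : submodule Wst) :
  whittaker_vector lambda v ->
  whittaker_vector (M := M) lambda (val (v : subspace_type W)).
Proof. by move=> vw x; apply: (congr1 val (vw x)). Qed.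

Lemma whittaker_image_simple (K : fieldType) (g : lieType K) (T : triangular g)
    (K0 : forall n, n.+1%:R != 0 :> K) (mu : dual (tri_h T)) (lambda : lieChar (tri_np T)) :
  simple_module (whittaker_image lambda mu) /\
  has_dim (whittaker_vector lambda (M := whittaker_image lambda mu)) 1.
Proof.
rewrite /whittaker_image; set f := whittaker_hom lambda mu.
have f_neq0 : exists m, f m <> 0.
  (* The lift of a functional with value 1 at the generator is nonzero, so [xget] does not fall back
     on its default. *)
  have [w [ww w1]] := whittaker_functional_exists lambda mu.
  have [F Fw] := whittaker_lift ww.
  apply: (@xgetPex _ (lie_hom0 _ _) [set f : lieHom _ _ | exists m, f m <> 0]).
  exists F, (whittaker_gen lambda) => F0; move: w1; rewrite -Fw F0.
  by move/eqP; rewrite eq_sym oner_eq0.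
(* The corestriction of [f] to its image is the surjection that the result on quotients asks for. *)
pose F0 (m : standard_whittaker lambda) : image_module f :=
  @in_sub K _ (image_space f) (f m) (ex_intro _ m erefl).
have F_lin : linear F0 by move=> c u v; apply: val_inj; apply: lie_hom_linear.
have F_act x v : F0 (lact x v) = lact x (F0 v) by apply: val_inj; apply: lie_hom_act.
pose F := LieHom F_lin F_act.
have F_surj v : exists m, v = F m.
  by have [m vm] := subspace_valP v; exists m; apply: val_inj.
have M_neq0 : exists v : image_module f, v <> 0.
  by have [m fm] := f_neq0; exists (F m) => Fm; apply: fm; apply: (congr1 val Fm).
suff line (u : image_module f) : whittaker_vector lambda u ->
    exists c : K, u = c *: F (whittaker_gen lambda).
  exact: (whittaker_quotient_simple (tri_np_finite_depth T K0) F_surj M_neq0 line).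
move=> uw.
pose w : dual (lowest_verma mu) := f (whittaker_gen lambda).
pose u' : dual (lowest_verma mu) := val u.
have wW : whittaker_vector (M := dual_module (lowest_verma mu)) lambda w.
  exact: (@whittaker_image_genP _ _ _ _ _ f).
(* A Whittaker functional vanishing at the generator is 0, whereas the generator of a nonzero image
   is not. *)
have w_neq0 : w (verma_gen mu) <> 0.
  move=> /(whittaker_functional_eq0 wW) w0.
  by apply: (whittaker_image_gen_neq0 F_surj M_neq0); apply: val_inj.
have uW : whittaker_vector (M := dual_module (lowest_verma mu)) lambda u'.
  exact: whittaker_vector_val uw.
have [c uE] := whittaker_functional_line uW wW w_neq0.
by exists c; apply: val_inj; apply: uE.
Qed.

Theorem corollary38 (R : realType) (g : lieType R[i])
    (g_countable : countable_dim g) (T : triangular g)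
    (mu : dual (tri_h T)) (lambda : lieChar (tri_np T)) :
  simple_module (whittaker_image lambda mu) /\
  has_dim (whittaker_vector lambda (M := whittaker_image lambda mu)) 1.
Proof.
by apply: whittaker_image_simple => n; rewrite Num.Theory.pnatr_eq0.
Qed.
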